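(* Let $P$ be a hole-free polyomino with $k$ vertices, and let $n$ be the side length of a smallest axis-parallel square containing $P$. Then there is a staged assembly system with temperature $\tau=1$ that constructs a fully connected version of $P$ with scale factor $4$ (i.e. a fully connected supertile of shape $P^4$) in $\mathcal{O}(\log^2 n)$ stages, with $18$ glues, $\mathcal{O}(1)$ tile types and $\mathcal{O}(k)$ bins.
   Context: Staged tile assembly model: A tile is a non-rotatable unit square with a glue from a finite alphabet (containing a null glue of strength $0$) on each side; a symmetric glue function assigns strengths in $\{0,\dots,\tau\}$, $\tau$ being the temperature. Supertiles (edge-connected sets of tiles on $\mathbb{Z}^2$) combine by translation without overlap if the total strength of matching glues along newly coincident edges is at least $\tau$. A bin holds supertiles, is closed under combination, and its terminal supertiles (those that cannot combine further) are passed on. A staged assembly system has $r$ stages of at most $b$ bins; stage-1 bins receive tile types, a stage-$i$ bin receives terminal supertiles of chosen stage-$(i-1)$ bins plus possibly new tile types; the output is the terminal supertiles of chosen last-stage bins, required to be a unique supertile of the target shape. Stage complexity $r$, bin complexity $b$, glue complexity = number of non-null glues, tile complexity = number of tile types. A supertile is fully connected if every two adjacent tiles share a positive-strength glue on their common edge. A polyomino is a connected union of unit squares (pixels) centered at points of $\mathbb{Z}^2$; its vertices are the corners of its boundary; hole-free means its complement has no bounded component; the $c$-scaled copy $P^c$ replaces each pixel by a $c\times c$ block, and constructing $P$ with scale factor $c$ means producing a supertile of shape $P^c$. *)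

(* Defs.v *)
From Stdlib Require Import ZArith List Arith Relations.
Import ListNotations.
Open Scope Z_scope.

Definition pos := (Z * Z)%type.
Definition padd (p v : pos) : pos := (fst p + fst v, snd p + snd v).
Definition psub (p v : pos) : pos := (fst p - fst v, snd p - snd v).
Definition adj (p q : pos) : Prop :=
  Z.abs (fst p - fst q) + Z.abs (snd p - snd q) = 1.

(** Glues are natural numbers; glue [0] is the null glue. *)
Definition glue := nat.
Record tile := mkTile { tN : glue; tE : glue; tS : glue; tW : glue }.

Definition glue_fun := glue -> glue -> nat.

Definition valid_glue_fun (tau : nat) (str : glue_fun) : Prop :=
  (forall g h, str g h = str h g) /\
  (forall g h, (str g h <= tau)%nat) /\
  (forall g, str 0%nat g = 0%nat).

Definition assembly := pos -> option tile.

Definition occupied (A : assembly) (p : pos) : Prop := A p <> None.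

Definition translate (A : assembly) (v : pos) : assembly :=
  fun p => A (psub p v).

Definition union (A B : assembly) : assembly :=
  fun p => match A p with Some t => Some t | None => B p end.

Definition single (t : tile) : assembly :=
  fun p => if (Z.eqb (fst p) 0 && Z.eqb (snd p) 0)%bool then Some t else None.

Definition bond (str : glue_fun) (a b : option tile) (ga gb : tile -> glue) : nat :=
  match a, b with
  | Some t, Some t' => str (ga t) (gb t')
  | _, _ => 0%nat
  end.

Definition bond_at (str : glue_fun) (A B : assembly) (p : pos) : nat :=
  Nat.add (bond str (A p) (B (fst p + 1, snd p)) tE tW)
  (Nat.add (bond str (A p) (B (fst p - 1, snd p)) tW tE)
  (Nat.add (bond str (A p) (B (fst p, snd p + 1)) tN tS)
           (bond str (A p) (B (fst p, snd p - 1)) tS tN))).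

Definition combinable (tau : nat) (str : glue_fun) (A B : assembly) : Prop :=
  (forall p, ~ (occupied A p /\ occupied B p)) /\
  exists LA : list pos,
    NoDup LA /\ (forall p, In p LA <-> occupied A p) /\
    (tau <= fold_right (fun p acc => bond_at str A B p + acc) 0 LA)%nat.

Inductive producible (tau : nat) (str : glue_fun) (inp : assembly -> Prop)
  : assembly -> Prop :=
| prod_in : forall A, inp A -> producible tau str inp A
| prod_tr : forall A v, producible tau str inp A ->
    producible tau str inp (translate A v)
| prod_comb : forall A B, producible tau str inp A -> producible tau str inp B ->
    combinable tau str A B -> producible tau str inp (union A B).

Definition terminal (tau : nat) (str : glue_fun) (inp : assembly -> Prop)
  (A : assembly) : Prop :=
  producible tau str inp A /\
  forall B, producible tau str inp B -> ~ combinable tau str A B.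

(** Stages are numbered [0 .. stages-1], bins [0 .. bins-1].
    [sys_tiles s j] = tile types added to bin [j] of stage [s];
    [sys_mix s j]   = bins of stage [s-1] whose terminal supertiles are
                      poured into bin [j] of stage [s];
    [sys_out]       = the chosen bins of the last stage. *)
Record system := mkSystem {
  sys_str : glue_fun;
  sys_stages : nat;
  sys_bins : nat;
  sys_tiles : nat -> nat -> list tile;
  sys_mix : nat -> nat -> list nat;
  sys_out : list nat }.

Definition valid_system (tau : nat) (S : system) : Prop :=
  valid_glue_fun tau (sys_str S) /\
  (1 <= sys_stages S)%nat /\
  (forall s j, (sys_stages S <= s \/ sys_bins S <= j)%nat ->
      sys_tiles S s j = [] /\ sys_mix S s j = []) /\
  (forall j, sys_mix S 0 j = []) /\
  (forall s j j', In j' (sys_mix S s j) -> (j' < sys_bins S)%nat) /\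
  (forall j, In j (sys_out S) -> (j < sys_bins S)%nat).

Fixpoint bin_terminal (tau : nat) (Sy : system) (s : nat) : nat -> assembly -> Prop :=
  match s with
  | O => fun j =>
      terminal tau (sys_str Sy)
        (fun A => exists t, In t (sys_tiles Sy 0 j) /\ A = single t)
  | S s' => fun j =>
      terminal tau (sys_str Sy)
        (fun A => (exists t, In t (sys_tiles Sy (S s') j) /\ A = single t) \/
                  (exists j', In j' (sys_mix Sy (S s') j) /\
                              bin_terminal tau Sy s' j' A))
  end.

Definition output (tau : nat) (S : system) (A : assembly) : Prop :=
  exists j, In j (sys_out S) /\ bin_terminal tau S (sys_stages S - 1) j A.

Definition tile_sides (t : tile) : list glue := [tN t; tE t; tS t; tW t].

Definition tile_complexity_le (S : system) (c : nat) : Prop :=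
  exists T : list tile, (length T <= c)%nat /\
    forall s j t, In t (sys_tiles S s j) -> In t T.

Definition glue_complexity_le (S : system) (c : nat) : Prop :=
  exists G : list glue, (length G <= c)%nat /\
    forall s j t g, In t (sys_tiles S s j) -> In g (tile_sides t) ->
      g <> 0%nat -> In g G.

Definition fully_connected (str : glue_fun) (A : assembly) : Prop :=
  forall p t t',
    (A p = Some t -> A (fst p + 1, snd p) = Some t' -> (0 < str (tE t) (tW t'))%nat) /\
    (A p = Some t -> A (fst p, snd p + 1) = Some t' -> (0 < str (tN t) (tS t'))%nat).

Definition has_shape (A : assembly) (Sh : pos -> Prop) : Prop :=
  exists v, forall q, occupied A q <-> Sh (psub q v).

(** * Polyominoes: finite sets of pixels, pixel p centered at p *)
Definition poly := list pos.

Definition connected_in (Q : pos -> Prop) (p q : pos) : Prop :=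
  clos_refl_trans pos (fun a b => Q a /\ Q b /\ adj a b) p q.

Definition polyomino (P : poly) : Prop :=
  P <> [] /\ forall p q, In p P -> In q P -> connected_in (fun a => In a P) p q.

(** complement has no bounded component: every free pixel is connected through
    free pixels to pixels arbitrarily far away *)
Definition hole_free (P : poly) : Prop :=
  forall q, ~ In q P -> forall M : Z, exists q',
    (M < Z.abs (fst q') \/ M < Z.abs (snd q')) /\
    connected_in (fun a => ~ In a P) q q'.

Definition memb (p : pos) (P : poly) : bool :=
  existsb (fun q => (Z.eqb (fst q) (fst p) && Z.eqb (snd q) (snd p))%bool) P.

(** lattice corner c = (x,y) stands for the point (x-1/2, y-1/2), shared by
    pixels (x-1,y-1),(x,y-1),(x-1,y),(x,y). It is a vertex (a corner of the
    boundary) iff an odd number of these pixels lie in P, or exactly two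
    diagonally opposite ones do. *)
Definition is_vertex (P : poly) (c : pos) : Prop :=
  let x := fst c in let y := snd c in
  let a := memb (x - 1, y - 1) P in
  let b := memb (x, y - 1) P in
  let c' := memb (x - 1, y) P in
  let d := memb (x, y) P in
  xorb (xorb a b) (xorb c' d) = true \/ (a = d /\ b = c' /\ a <> b).

Definition vertex_count (P : poly) (k : nat) : Prop :=
  exists L : list pos, NoDup L /\ (forall c, In c L <-> is_vertex P c) /\
    length L = k.

Definition in_square (P : poly) (a b : Z) (s : nat) : Prop :=
  forall p, In p P ->
    a <= fst p < a + Z.of_nat s /\ b <= snd p < b + Z.of_nat s.

Definition min_square_side (P : poly) (n : nat) : Prop :=
  (exists a b, in_square P a b n) /\
  forall s, (s < n)%nat -> ~ exists a b, in_square P a b s.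

Definition scaled (c : Z) (P : poly) (q : pos) : Prop :=
  exists p, In p P /\
    c * fst p <= fst q < c * fst p + c /\ c * snd p <= snd q < c * snd p + c.

Definition constructs_fc (tau : nat) (S : system) (Sh : pos -> Prop) : Prop :=
  exists A, output tau S A /\ fully_connected (sys_str S) A /\ has_shape A Sh /\
    forall B, output tau S B -> exists v, forall q, B q = translate A v q.

(* Main.v *)
(** The shape is assembled as a closed ring of boundary cells that is flooded
    from inside in the last stage.

    The ring consists of the cells of [P^4] with one of their eight neighbours
    outside [P^4]. Each of its cells is determined by the direction in which
    the boundary walk enters and leaves it. The winding number of one cycle of
    the walk is constant on [P] and, [P] being hole-free, zero off [P], so it
    jumps by the same amount along the whole boundary: the walk is one cycle.
    It turns only at vertices, so it is a word with O(k) maximal constant runs.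

    A path with head colour [a] and tail colour [b] sticks to one from [b] to
    [c] in exactly one way if [a], [b], [c] are distinct, and both are inert by
    themselves. Powers and concatenations of words are therefore built by
    doubling in O(log n) stages, six glues sufficing for the three colours; a
    last cell joins both ends of the path.

    Filler tiles stick to each other and to the inner sides of the ring. A
    supertile made of fillers alone can always grow, hence is never terminal;
    fillers attached to a ring cannot leave it; and two disjoint rings cannot
    meet inside one another. The filled ring is the only terminal supertile. *)
Require Import Defs.
From Stdlib Require Import ZArith List Arith.
From Stdlib Require Import Lia Bool Classical FunctionalExtensionality FinFun.
Import ListNotations.
Open Scope Z_scope.

(** * Paths of tiles and their joins *)

(** At temperature 1 a single matching side joins two supertiles, so every accidental contact has to
    be excluded. For the ring this is what scale 4 provides: strands along opposite sides of a pixel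
    are two cells apart, and two adjacent ring cells are always consecutive on the walk. Moreover
    the inner glue does not bond to itself, only to fillers.

    The colours at the ends of a path depend on where the path is used next. Each word is therefore
    kept in nine bins, one per ordered pair of end colours, a constant factor. A run with count [e]
    occupies two slots, for the exponents [q] and [q + 1], because this pair is closed under
    appending a binary digit to [q]. With at most [9 * k] runs this gives O(k) bins, and the number
    of stages is linear in [log n].

    All geometry near the boundary depends on 3 x 3 pixels only and is settled by evaluation. Two
    arguments are global: the winding number, which shows that the walk is a single cycle, and a
    comparison of extreme coordinates, which shows that no ring fits inside a translate of
    itself. *)

Inductive dir := DN | DE | DS | DW.

Definition dir_eq_dec (a b : dir) : {a = b} + {a <> b}.
Proof. decide equality. Defined.

Definition pos_eq_dec (p q : pos) : {p = q} + {p <> q}.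
Proof. decide equality; apply Z.eq_dec. Qed.

Definition vec (d : dir) : pos :=
  match d with DN => (0, 1) | DE => (1, 0) | DS => (0, -1) | DW => (-1, 0) end.

Definition opp (d : dir) : dir :=
  match d with DN => DS | DE => DW | DS => DN | DW => DE end.

Definition left_of (d : dir) : dir :=
  match d with DN => DW | DE => DN | DS => DE | DW => DS end.

Definition step (p : pos) (d : dir) : pos := padd p (vec d).

Definition side (t : tile) (d : dir) : glue :=
  match d with DN => tN t | DE => tE t | DS => tS t | DW => tW t end.

Lemma opp_opp d : opp (opp d) = d.
Proof. destruct d; reflexivity. Qed.

Lemma opp_inj d e : opp d = opp e -> d = e.
Proof. destruct d, e; simpl; congruence. Qed.

Ltac pos_solve :=
  unfold step, padd, psub, vec in *; simpl in *;
  repeat match goal with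
         | p : pos |- _ => destruct p; simpl in *
         | p : (Z * Z)%type |- _ => destruct p; simpl in *
         end;
  repeat match goal with
         | H : (_, _) = (_, _) |- _ => injection H; clear H; intros
         end;
  try (f_equal; lia); try lia.

Lemma step_opp p d : step (step p d) (opp d) = p.
Proof. destruct d; pos_solve. Qed.

Lemma opp_step p d : step (step p (opp d)) d = p.
Proof. destruct d; pos_solve. Qed.

Lemma step_psub p v d : psub (step p d) v = step (psub p v) d.
Proof. destruct d; pos_solve. Qed.

Lemma psub_padd p v : psub (padd p v) v = p.
Proof. pos_solve. Qed.

Lemma padd_psub p v : padd (psub p v) v = p.
Proof. pos_solve. Qed.

Lemma step_east p : step p DE = (fst p + 1, snd p).
Proof. pos_solve. Qed.

Lemma step_north p : step p DN = (fst p, snd p + 1).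
Proof. pos_solve. Qed.

Lemma psub_0 p : psub p (0, 0) = p.
Proof. pos_solve. Qed.

Lemma step_neq p d : step p d <> p.
Proof. destruct d; intros H; pos_solve. Qed.

(** * Bonds and combination at temperature 1 *)

Definition bonded (str : glue_fun) (A B : assembly) : Prop :=
  exists p d t t', A p = Some t /\ B (step p d) = Some t' /\
    (0 < str (side t d) (side t' (opp d)))%nat.

Definition disjoint (A B : assembly) : Prop :=
  forall p, ~ (occupied A p /\ occupied B p).

Definition finite_asm (A : assembly) : Prop :=
  exists L : list pos, forall p, occupied A p -> In p L.

Lemma occupied_dec A p : {occupied A p} + {~ occupied A p}.
Proof.
  unfold occupied; destruct (A p); [left | right]; congruence.
Qed.

Lemma occupied_some A p t : A p = Some t -> occupied A p.
Proof. unfold occupied; congruence. Qed.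

Lemma occupied_ex A p : occupied A p -> exists t, A p = Some t.
Proof. unfold occupied; destruct (A p); [eauto | congruence]. Qed.

Lemma finite_asm_NoDup A :
  finite_asm A ->
  exists LA : list pos, NoDup LA /\ forall p, In p LA <-> occupied A p.
Proof.
  intros [L HL].
  exists (nodup pos_eq_dec
            (filter (fun p => if occupied_dec A p then true else false) L)).
  split; [apply NoDup_nodup |].
  intros p; rewrite nodup_In, filter_In.
  destruct (occupied_dec A p); split; intuition (auto; congruence).
Qed.

Lemma bond_at_pos str A B p :
  (0 < bond_at str A B p)%nat <->
  exists d t t', A p = Some t /\ B (step p d) = Some t' /\
    (0 < str (side t d) (side t' (opp d)))%nat.
Proof.
  unfold bond_at.
  replace (fst p + 1, snd p) with (step p DE) by pos_solve.
  replace (fst p - 1, snd p) with (step p DW) by pos_solve.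
  replace (fst p, snd p + 1) with (step p DN) by pos_solve.
  replace (fst p, snd p - 1) with (step p DS) by pos_solve.
  split.
  - intros H.
    assert (Hd : exists d, (0 < bond str (A p) (B (step p d))
                  (fun t => side t d) (fun t => side t (opp d)))%nat).
    { destruct (Nat.eq_dec (bond str (A p) (B (step p DE)) tE tW) 0);
        [| exists DE; change (0 < bond str (A p) (B (step p DE)) tE tW)%nat; lia].
      destruct (Nat.eq_dec (bond str (A p) (B (step p DW)) tW tE) 0);
        [| exists DW; change (0 < bond str (A p) (B (step p DW)) tW tE)%nat; lia].
      destruct (Nat.eq_dec (bond str (A p) (B (step p DN)) tN tS) 0);
        [| exists DN; change (0 < bond str (A p) (B (step p DN)) tN tS)%nat; lia].
      exists DS; change (0 < bond str (A p) (B (step p DS)) tS tN)%nat; lia. }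
    destruct Hd as [d Hd]; unfold bond in Hd.
    destruct (A p) as [t |] eqn:HA; [| lia].
    destruct (B (step p d)) as [t' |] eqn:HB; [| lia].
    exists d, t, t'; auto.
  - intros (d & t & t' & HA & HB & H).
    destruct d; rewrite HA, HB; unfold bond at 1 2 3 4; simpl in *; lia.
Qed.

Lemma sum_pos {X} (f : X -> nat) l :
  (1 <= fold_right (fun p acc => f p + acc) 0 l)%nat <->
  exists p, In p l /\ (0 < f p)%nat.
Proof.
  induction l as [| x l IH]; simpl.
  - split; [lia | intros (p & [] & _)].
  - split.
    + intros H; destruct (Nat.eq_dec (f x) 0) as [e | e].
      * destruct (proj1 IH) as (p & Hp & Hf); [lia |]; eauto.
      * exists x; split; [auto | lia].
    + intros (p & [-> | Hp] & Hf); [lia |].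
      assert (1 <= fold_right (fun p acc => f p + acc) 0 l)%nat
        by (apply IH; eauto).
      lia.
Qed.

(** A sum of strengths reaches 1 exactly when one of its terms is positive. Finiteness is asked of
    [A] alone because the sum runs over a list of the cells of [A]. *)
Lemma combinable_iff str A B :
  combinable 1 str A B <-> disjoint A B /\ finite_asm A /\ bonded str A B.
Proof.
  unfold combinable, disjoint; split.
  - intros (Hd & LA & _ & HLA & Hs); split; [exact Hd |]; split.
    + exists LA; intros p; apply HLA.
    + apply sum_pos in Hs; destruct Hs as (p & Hp & Hf).
      apply bond_at_pos in Hf; exists p; exact Hf.
  - intros (Hd & Hf & p & d & t & t' & HA & HB & H); split; [exact Hd |].
    destruct (finite_asm_NoDup A Hf) as (LA & Hnd & HLA).
    exists LA; split; [exact Hnd |]; split; [exact HLA |].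
    apply sum_pos; exists p; split.
    + apply HLA; eapply occupied_some; eauto.
    + apply bond_at_pos; exists d, t, t'; auto.
Qed.

Lemma bonded_sym str A B :
  (forall g h, str g h = str h g) -> bonded str A B -> bonded str B A.
Proof.
  intros Hs (p & d & t & t' & HA & HB & H).
  exists (step p d), (opp d), t', t; rewrite step_opp, opp_opp, Hs; auto.
Qed.

Lemma disjoint_sym (A B : assembly) : disjoint A B -> disjoint B A.
Proof. intros H p [HB HA]; apply (H p); auto. Qed.

Lemma union_comm (A B : assembly) : disjoint A B -> union A B = union B A.
Proof.
  intros H; extensionality p; unfold union.
  specialize (H p); unfold occupied in H.
  destruct (A p), (B p); try reflexivity.
  exfalso; apply H; split; congruence.
Qed.

Lemma occupied_union A B p :
  occupied (union A B) p <-> occupied A p \/ occupied B p.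
Proof.
  unfold occupied, union; destruct (A p), (B p); intuition congruence.
Qed.

Lemma finite_union A B : finite_asm A -> finite_asm B -> finite_asm (union A B).
Proof.
  intros [L HL] [M HM]; exists (L ++ M); intros p Hp.
  apply in_or_app; apply occupied_union in Hp; destruct Hp; auto.
Qed.

Lemma finite_translate A v : finite_asm A -> finite_asm (translate A v).
Proof.
  intros [L HL]; exists (map (fun p => padd p v) L); intros p Hp.
  apply in_map_iff; exists (psub p v); split; [apply padd_psub | auto].
Qed.

Lemma translate_translate A u v :
  translate (translate A u) v = translate A (padd u v).
Proof.
  extensionality p; unfold translate; f_equal; pos_solve.
Qed.

Lemma translate_0 A : translate A (0, 0) = A.
Proof.
  extensionality p; unfold translate; f_equal; pos_solve.
Qed.

Lemma single_some t p u : single t p = Some u <-> p = (0, 0) /\ u = t.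
Proof.
  unfold single; destruct p as [x y]; simpl.
  destruct (Z.eqb_spec x 0), (Z.eqb_spec y 0); simpl; split;
    try (intros [H ->]; injection H; intros; subst; try lia; reflexivity);
    intros H; try discriminate; injection H; subst; auto.
Qed.

(** Glues [1..3] are the heads and [4..6] the tails of the three joint
    colours, [7] is the glue of the filler tile, [8] marks sides facing the
    interior. *)
Inductive color := C0 | C1 | C2.

Definition head_glue (c : color) : glue :=
  match c with C0 => 1 | C1 => 2 | C2 => 3 end%nat.
Definition tail_glue (c : color) : glue :=
  match c with C0 => 4 | C1 => 5 | C2 => 6 end%nat.
Definition fill_glue : glue := 7%nat.
Definition inner_glue : glue := 8%nat.

Definition str : glue_fun := fun a b =>
  match a, b with
  | 1, 4 | 4, 1 | 2, 5 | 5, 2 | 3, 6 | 6, 3 | 7, 7 | 7, 8 | 8, 7 => 1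
  | _, _ => 0
  end%nat.

Lemma str_valid : valid_glue_fun 1 str.
Proof.
  repeat split.
  - intros g h; do 9 (destruct g as [| g]; [do 9 (destruct h as [| h]; [reflexivity |]); reflexivity |]).
    do 9 (destruct h as [| h]; [reflexivity |]); reflexivity.
  - intros g h; do 9 (destruct g as [| g]; [do 9 (destruct h as [| h]; [cbn; lia |]); cbn; lia |]).
    cbn; lia.
Qed.

Lemma str_sym g h : str g h = str h g.
Proof. apply str_valid. Qed.

Lemma bonded_str_sym A B : bonded str A B -> bonded str B A.
Proof. apply bonded_sym, str_sym. Qed.

(** A letter [(d, e)] is a cell entered by a move in direction [d] and left in
    direction [e]; the boundary is traversed with the interior on the left. *)
Definition letter := (dir * dir)%type.

Record ctile := CT { ct_in : dir; ct_out : dir; ct_ci : color; ct_co : color }.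

(** The glue on a side [f] that is neither entry nor exit. A straight cell has the interior on its
    left. A left turn is a convex corner, with both free sides outside; a right turn is a reflex
    corner, with both free sides towards the interior. *)
Definition free_side (d e f : dir) : glue :=
  if dir_eq_dec e d then (if dir_eq_dec f (left_of e) then inner_glue else 0%nat)
  else if dir_eq_dec e (left_of d) then 0%nat else inner_glue.

Definition ct_side (x : ctile) (f : dir) : glue :=
  if dir_eq_dec f (ct_out x) then tail_glue (ct_co x)
  else if dir_eq_dec f (opp (ct_in x)) then head_glue (ct_ci x)
  else free_side (ct_in x) (ct_out x) f.

Definition ct_tile (x : ctile) : tile :=
  mkTile (ct_side x DN) (ct_side x DE) (ct_side x DS) (ct_side x DW).

Definition filler : tile := mkTile fill_glue fill_glue fill_glue fill_glue.

Lemma side_ct_tile x d : side (ct_tile x) d = ct_side x d.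
Proof. destruct d; reflexivity. Qed.

Lemma side_filler d : side filler d = fill_glue.
Proof. destruct d; reflexivity. Qed.

Lemma str_tail_head c c' : (0 < str (tail_glue c) (head_glue c'))%nat -> c = c'.
Proof. destruct c, c'; simpl; intros; (reflexivity || lia). Qed.

Lemma ct_side_cases x d :
  (d = ct_out x /\ ct_side x d = tail_glue (ct_co x)) \/
  (d = opp (ct_in x) /\ ct_side x d = head_glue (ct_ci x)) \/
  ct_side x d = inner_glue \/ ct_side x d = 0%nat.
Proof.
  unfold ct_side, free_side.
  repeat match goal with |- context [dir_eq_dec ?a ?b] => destruct (dir_eq_dec a b) end;
    auto.
Qed.

(** Head and tail glues bond only to each other and only in equal colours, and the inner glue bonds
    to the filler glue alone. What remains is the exit of one cell against the entry of the
    other. *)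
Lemma ct_bond x y d :
  (0 < str (side (ct_tile x) d) (side (ct_tile y) (opp d)))%nat ->
  (d = ct_out x /\ d = ct_in y /\ ct_co x = ct_ci y) \/
  (opp d = ct_out y /\ opp d = ct_in x /\ ct_co y = ct_ci x).
Proof.
  rewrite !side_ct_tile; intros H.
  destruct (ct_side_cases x d) as [[E1 F1] | [[E1 F1] | [F1 | F1]]];
    destruct (ct_side_cases y (opp d)) as [[E2 F2] | [[E2 F2] | [F2 | F2]]];
    rewrite F1, F2 in H;
    try (exfalso; revert H; unfold inner_glue, tail_glue, head_glue;
         destruct (ct_co x), (ct_co y), (ct_ci x), (ct_ci y); simpl; lia).
  - left; split; [exact E1 |]; split; [apply opp_inj; exact E2 |].
    apply str_tail_head; exact H.
  - right; split; [exact E2 |].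
    rewrite str_sym in H; apply str_tail_head in H; split; [| exact H].
    rewrite E1; apply opp_opp.
Qed.

(** * Paths of cells laid in the plane *)

Fixpoint cells (p : pos) (w : list letter) : list pos :=
  match w with
  | [] => []
  | l :: w' => p :: cells (step p (snd l)) w'
  end.

Fixpoint endp (p : pos) (w : list letter) : pos :=
  match w with
  | [] => p
  | l :: w' => endp (step p (snd l)) w'
  end.

Definition ct_letter (x : ctile) : letter := (ct_in x, ct_out x).

Fixpoint trace (p : pos) (tw : list ctile) : list (pos * ctile) :=
  match tw with
  | [] => []
  | x :: tw' => (p, x) :: trace (step p (ct_out x)) tw'
  end.

Fixpoint lay (p : pos) (tw : list ctile) : assembly :=
  match tw with
  | [] => fun _ => None
  | x :: tw' => fun q =>
      if pos_eq_dec q p then Some (ct_tile x) else lay (step p (ct_out x)) tw' q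
  end.

(** Besides the colours of the two open ends, their directions are recorded, since a joint must
    match in both. *)
Fixpoint chain (a : color) (d : dir) (tw : list ctile) (b : color) (e : dir) : Prop :=
  match tw with
  | [] => a = b /\ d = e
  | x :: tw' => ct_ci x = a /\ ct_in x = d /\ chain (ct_co x) (ct_out x) tw' b e
  end.

Lemma cells_app p u v : cells p (u ++ v) = cells p u ++ cells (endp p u) v.
Proof. revert p; induction u as [| l u IH]; intros p; simpl; [| rewrite IH]; auto. Qed.

Lemma endp_app p u v : endp p (u ++ v) = endp (endp p u) v.
Proof. revert p; induction u; intros p; simpl; auto. Qed.

Lemma endp_padd p v w : endp (padd p v) w = padd (endp p w) v.
Proof.
  revert p; induction w as [| l w IH]; simpl; intros p; [reflexivity |].
  rewrite <- IH; f_equal; destruct (snd l); pos_solve.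
Qed.

Lemma cells_padd p v w : cells (padd p v) w = map (fun q => padd q v) (cells p w).
Proof.
  revert p; induction w as [| l w IH]; simpl; intros p; [reflexivity |].
  rewrite <- IH; f_equal; f_equal; destruct (snd l); pos_solve.
Qed.

Lemma endp_surj w p : exists q, endp q w = p.
Proof.
  exists (psub p (psub (endp p w) p)).
  replace (psub p (psub (endp p w) p)) with (padd p (psub p (endp p w))) by pos_solve.
  rewrite endp_padd; pos_solve.
Qed.

Lemma map_fst_trace p tw : map fst (trace p tw) = cells p (map ct_letter tw).
Proof. revert p; induction tw; intros p; simpl; [| rewrite IHtw]; auto. Qed.

Lemma cells_trace p tw q :
  In q (cells p (map ct_letter tw)) <-> exists x, In (q, x) (trace p tw).
Proof.
  rewrite <- map_fst_trace, in_map_iff; split.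
  - intros ([q' x] & <- & H); exists x; exact H.
  - intros (x & H); exists (q, x); auto.
Qed.

Lemma lay_trace p tw q t :
  lay p tw q = Some t -> exists x, In (q, x) (trace p tw) /\ t = ct_tile x.
Proof.
  revert p; induction tw as [| x tw IH]; intros p; simpl; [discriminate |].
  destruct (pos_eq_dec q p) as [-> | _].
  - intros [= <-]; eauto.
  - intros H; destruct (IH _ H) as (y & Hy & ->); eauto.
Qed.

Lemma trace_lay p tw q x :
  NoDup (cells p (map ct_letter tw)) -> In (q, x) (trace p tw) ->
  lay p tw q = Some (ct_tile x).
Proof.
  revert p; induction tw as [| y tw IH]; intros p; simpl; [tauto |].
  rewrite NoDup_cons_iff; intros [Hn Hd] [[= <- <-] | H].
  - destruct (pos_eq_dec p p); congruence.
  - destruct (pos_eq_dec q p) as [-> | _]; [| auto].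
    exfalso; apply Hn, cells_trace; eauto.
Qed.

Lemma occupied_lay p tw q : occupied (lay p tw) q <-> In q (cells p (map ct_letter tw)).
Proof.
  unfold occupied; revert p; induction tw as [| x tw IH]; intros p; simpl;
    [tauto |].
  destruct (pos_eq_dec q p) as [-> | n].
  - split; [auto | discriminate].
  - rewrite IH; split; [auto | intros [-> | H]; [congruence | exact H]].
Qed.

Lemma finite_lay p tw : finite_asm (lay p tw).
Proof. exists (cells p (map ct_letter tw)); intros q; apply occupied_lay. Qed.

Lemma translate_lay p tw v : translate (lay p tw) v = lay (padd p v) tw.
Proof.
  revert p; induction tw as [| x tw IH]; intros p; simpl; [reflexivity |].
  extensionality q; unfold translate at 1.
  replace (step (padd p v) (ct_out x)) with (padd (step p (ct_out x)) v)
    by (destruct (ct_out x); pos_solve).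
  rewrite <- IH.
  destruct (pos_eq_dec (psub q v) p) as [E | n];
    destruct (pos_eq_dec q (padd p v)) as [E' | n']; try reflexivity; exfalso.
  - apply n'; rewrite <- E; symmetry; apply padd_psub.
  - apply n; rewrite E'; apply psub_padd.
Qed.

Lemma lay_app p u v :
  lay p (u ++ v) = union (lay p u) (lay (endp p (map ct_letter u)) v).
Proof.
  revert p; induction u as [| x u IH]; intros p; simpl; [reflexivity |].
  extensionality q; rewrite IH; unfold union.
  destruct (pos_eq_dec q p); reflexivity.
Qed.

Lemma chain_app a d u b e v c f :
  chain a d u b e -> chain b e v c f -> chain a d (u ++ v) c f.
Proof.
  revert a d; induction u as [| x u IH]; simpl; intros a d.
  - intros [-> ->]; auto.
  - intros (H1 & H2 & H3) H4; repeat split; auto.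
Qed.

Lemma chain_next a d tw b e p q x :
  chain a d tw b e -> In (q, x) (trace p tw) ->
  (exists y, In (step q (ct_out x), y) (trace p tw) /\
     ct_in y = ct_out x /\ ct_ci y = ct_co x) \/
  (step q (ct_out x) = endp p (map ct_letter tw) /\ ct_co x = b /\ ct_out x = e).
Proof.
  revert a d p; induction tw as [| z tw IH]; simpl; intros a d p; [tauto |].
  intros (H1 & H2 & H3) [[= <- <-] | H].
  - destruct tw as [| y tw]; simpl in *.
    + right; destruct H3; auto.
    + left; exists y; destruct H3 as (? & ? & _); auto.
  - destruct (IH _ _ _ H3 H) as [(y & Hy & Hy') | Hl]; eauto.
Qed.

Lemma chain_prev a d tw b e p q x :
  chain a d tw b e -> In (q, x) (trace p tw) ->
  (exists y, In (step q (opp (ct_in x)), y) (trace p tw) /\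
     ct_out y = ct_in x /\ ct_co y = ct_ci x) \/
  (q = p /\ ct_ci x = a /\ ct_in x = d).
Proof.
  revert a d p; induction tw as [| z tw IH]; simpl; intros a d p; [tauto |].
  intros (H1 & H2 & H3) [[= <- <-] | H].
  - right; auto.
  - destruct (IH _ _ _ H3 H) as [(y & Hy & Hy') | (-> & Hc & Hd)]; [eauto 6 |].
    left; exists z; rewrite Hc, Hd; split; [| auto].
    left; f_equal; symmetry; apply step_opp.
Qed.

Lemma chain_last a d tw b e p :
  chain a d tw b e -> tw <> [] ->
  exists x, In (step (endp p (map ct_letter tw)) (opp e), x) (trace p tw) /\
    ct_co x = b /\ ct_out x = e.
Proof.
  revert a d p; induction tw as [| z tw IH]; simpl; intros a d p; [congruence |].
  intros (H1 & H2 & H3) _; destruct tw as [| y tw].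
  - destruct H3 as [<- <-]; exists z; simpl; rewrite step_opp; auto.
  - destruct (IH _ _ (step p (ct_out z)) H3) as (x & Hx & Hx'); [discriminate |].
    exists x; split; [right; exact Hx | exact Hx'].
Qed.

(** An inner joint of a path is already used: the cell across it belongs to the same path, so a
    disjoint path cannot be there. A bond between disjoint paths thus pairs the end of one with the
    start of the other. *)
Lemma lay_link a1 d1 w1 b1 e1 a2 d2 w2 b2 e2 p1 p2 :
  chain a1 d1 w1 b1 e1 -> chain a2 d2 w2 b2 e2 ->
  disjoint (lay p1 w1) (lay p2 w2) -> bonded str (lay p1 w1) (lay p2 w2) ->
  (endp p1 (map ct_letter w1) = p2 /\ b1 = a2 /\ e1 = d2) \/
  (endp p2 (map ct_letter w2) = p1 /\ b2 = a1 /\ e2 = d1).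
Proof.
  (* One orientation suffices: the exit of a cell of the first path meets the entry of a cell of the
     second. The other is the same with the paths exchanged. *)
  assert (main : forall a1 d1 w1 b1 e1 a2 d2 w2 b2 e2 p1 p2 q x y,
    chain a1 d1 w1 b1 e1 -> chain a2 d2 w2 b2 e2 ->
    disjoint (lay p1 w1) (lay p2 w2) ->
    In (q, x) (trace p1 w1) -> In (step q (ct_out x), y) (trace p2 w2) ->
    ct_in y = ct_out x -> ct_co x = ct_ci y ->
    endp p1 (map ct_letter w1) = p2 /\ b1 = a2 /\ e1 = d2).
  { clear; intros a1 d1 w1 b1 e1 a2 d2 w2 b2 e2 p1 p2 q x y H1 H2 Hd Hx Hy Hio Hc.
    destruct (chain_next _ _ _ _ _ _ _ _ H1 Hx) as [(z & Hz & _) | (E1 & E2 & E3)].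
    { exfalso; apply (Hd (step q (ct_out x))); rewrite !occupied_lay, !cells_trace; eauto. }
    destruct (chain_prev _ _ _ _ _ _ _ _ H2 Hy) as [(z & Hz & _) | (F1 & F2 & F3)].
    { exfalso; apply (Hd q); rewrite !occupied_lay, !cells_trace.
      rewrite Hio, step_opp in Hz; eauto. }
    repeat split; congruence. }
  intros H1 H2 Hd (q & f & t & t' & HA & HB & H).
  apply lay_trace in HA, HB; destruct HA as (x & Hx & ->), HB as (y & Hy & ->).
  destruct (ct_bond _ _ _ H) as [(E1 & E2 & E3) | (E1 & E2 & E3)].
  - left; subst f; eapply (main a1 d1 w1 b1 e1 a2 d2 w2 b2 e2); eauto.
  - right; eapply (main a2 d2 w2 b2 e2 a1 d1 w1 b1 e1 p2 p1 (step q f) y x);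
      eauto using disjoint_sym; rewrite <- E1; [rewrite step_opp; exact Hx | auto].
Qed.

Lemma lay_join a d u b e v c f p :
  chain a d u b e -> chain b e v c f -> u <> [] -> v <> [] ->
  NoDup (cells p (map ct_letter (u ++ v))) ->
  (forall x, In x (u ++ v) -> ct_out x <> opp (ct_in x)) ->
  combinable 1 str (lay p u) (lay (endp p (map ct_letter u)) v).
Proof.
  intros H1 H2 Hu Hv Hn Hx; rewrite map_app, cells_app in Hn.
  apply combinable_iff; split; [| split; [apply finite_lay |]].
  - intros q [Hq1 Hq2]; apply occupied_lay in Hq1, Hq2.
    revert Hn Hq1 Hq2; generalize (cells (endp p (map ct_letter u)) (map ct_letter v)) as M.
    generalize (cells p (map ct_letter u)) as L; intros L M.
    induction L as [| z L IH]; simpl; [tauto |].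
    rewrite NoDup_cons_iff; intros [Hz HL] [-> | Hq] HM; [apply Hz, in_or_app; auto | exact (IH HL Hq HM)].
  - destruct (chain_last a d u b e p H1 Hu) as (x & Ix & <- & <-).
    destruct v as [| y v]; [congruence |]; simpl in H2.
    destruct H2 as (E1 & E2 & _).
    exists (step (endp p (map ct_letter u)) (opp (ct_out x))), (ct_out x), (ct_tile x), (ct_tile y).
    split; [| split].
    + apply trace_lay; [| exact Ix].
      eapply NoDup_app_remove_r; exact Hn.
    + rewrite opp_step; simpl.
      destruct (pos_eq_dec (endp p (map ct_letter u)) (endp p (map ct_letter u))); congruence.
    + rewrite !side_ct_tile; unfold ct_side.
      destruct (dir_eq_dec (ct_out x) (ct_out x)); [| congruence].
      (* [ct_side] tests the exit before the entry, so the head glue of [y] is visible only because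
         [y] does not turn back. *)
      destruct (dir_eq_dec (opp (ct_out x)) (ct_out y)) as [E | _].
      { exfalso; apply (Hx y); [apply in_or_app; simpl; auto | congruence]. }
      destruct (dir_eq_dec (opp (ct_out x)) (opp (ct_in y))); [| congruence].
      rewrite E1; destruct (ct_co x); simpl; lia.
Qed.

(** * Bins that pass on one path or join two *)

Definition copies (tw : list ctile) (A : assembly) : Prop := exists p, A = lay p tw.

Lemma copies_lay tw p : copies tw (lay p tw).
Proof. exists p; reflexivity. Qed.

Definition feeds (inp : assembly -> Prop) (tws : list (list ctile)) : Prop :=
  (forall A, inp A -> exists tw, In tw tws /\ copies tw A) /\
  (forall tw, In tw tws -> exists p, inp (lay p tw)).

Lemma feeds_producible inp tws tw p :
  feeds inp tws -> In tw tws -> producible 1 str inp (lay p tw).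
Proof.
  intros [_ H] Hi; destruct (H tw Hi) as [q Hq].
  replace (lay p tw) with (translate (lay q tw) (psub p q)).
  - apply prod_tr, prod_in, Hq.
  - rewrite translate_lay; f_equal; pos_solve.
Qed.

(** A bond between two copies would put the end colour [b] against the start colour [a], and these
    differ. *)
Lemma lonely_bin inp tw a d b e :
  feeds inp [tw] -> chain a d tw b e -> a <> b ->
  forall A, terminal 1 str inp A <-> copies tw A.
Proof.
  intros Hf Hc Hab.
  assert (Hn : forall p q, ~ combinable 1 str (lay p tw) (lay q tw)).
  { intros p q H; apply combinable_iff in H; destruct H as (Hd & _ & Hb).
    destruct (lay_link _ _ _ _ _ _ _ _ _ _ _ _ Hc Hc Hd Hb)
      as [(_ & H & _) | (_ & H & _)]; congruence. }
  assert (Hp : forall A, producible 1 str inp A -> copies tw A).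
  { intros A HA; induction HA as [A HA | A v HA [p ->] | A B HA [p ->] HB [q ->] H].
    - destruct (proj1 Hf A HA) as (tw' & [<- | []] & H); exact H.
    - rewrite translate_lay; apply copies_lay.
    - exfalso; exact (Hn _ _ H). }
  intros A; split.
  - intros [HA _]; auto.
  - intros [p ->]; split.
    + eapply feeds_producible; [exact Hf | simpl; auto].
    + intros B HB; destruct (Hp B HB) as [q ->]; apply Hn.
Qed.

(** The same statement covers open joins ([a <> c]) and the join that closes a
    ring ([a = c]); in the latter both bonds force the same placement. *)
Lemma join_bin inp u v a d b e c f :
  feeds inp [u; v] -> chain a d u b e -> chain b e v c f -> u <> [] -> v <> [] ->
  a <> b -> b <> c ->
  (forall p, NoDup (cells p (map ct_letter (u ++ v)))) ->
  (forall x, In x (u ++ v) -> ct_out x <> opp (ct_in x)) ->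
  (a = c -> f = d /\ forall p, endp p (map ct_letter (u ++ v)) = p) ->
  forall A, terminal 1 str inp A <-> copies (u ++ v) A.
Proof.
  intros Hf Hu Hv Nu Nv Hab Hbc Hn Hx Hring.
  assert (Hz : chain a d (u ++ v) c f) by (eapply chain_app; eauto).
  (* The bond from the end of [v] to the start of [u] needs [a = c]; the joined word is then closed,
     and this bond places [v] where the bond from [u] to [v] places it. *)
  assert (Huv : forall p q, disjoint (lay p u) (lay q v) ->
    bonded str (lay p u) (lay q v) -> q = endp p (map ct_letter u)).
  { intros p q Hd Hb.
    destruct (lay_link _ _ _ _ _ _ _ _ _ _ _ _ Hu Hv Hd Hb)
      as [(E & _ & _) | (E & Ec & _)]; [auto |].
    destruct (Hring (eq_sym Ec)) as [_ Hr].
    specialize (Hr q).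
    subst p.
    rewrite map_app, endp_app in Hr.
    replace (endp q (map ct_letter v)) with
      (padd (endp (endp q (map ct_letter u)) (map ct_letter v)) (psub q (endp q (map ct_letter u)))).
    2: { rewrite <- endp_padd; f_equal; pos_solve. }
    rewrite Hr, endp_padd; pos_solve. }
  assert (Hclosed : forall p q w x g y h, (w = u \/ w = v \/ w = u ++ v) ->
    chain x g w y h ->
    disjoint (lay p (u ++ v)) (lay q w) -> ~ bonded str (lay p (u ++ v)) (lay q w)).
  { intros p q w x g y h Hw Hc Hd Hb.
    assert (Nw : w <> []).
    { destruct Hw as [-> | [-> | ->]]; auto.
      intros E; apply app_eq_nil in E; tauto. }
    assert (Ec : a = c \/ a <> c) by (destruct a, c; auto; right; congruence).
    destruct Ec as [Ec | Ec].
    (* A closed ring ends at its own start. A path attached at that joint would cover the first or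
       the last cell of the ring. *)
    - destruct (Hring Ec) as [Ef Hr].
      destruct (lay_link _ _ _ _ _ _ _ _ _ _ _ _ Hz Hc Hd Hb)
        as [(E & _) | (E & _ & Eh)].
      + rewrite Hr in E; subst q; apply (Hd p); rewrite !occupied_lay.
        destruct u; [congruence |]; destruct w; [congruence |]; simpl; auto.
      + subst h f.
        destruct (chain_last _ _ _ _ _ p Hz) as (z & Iz & _).
        { intros E'; apply app_eq_nil in E'; tauto. }
        destruct (chain_last _ _ _ _ _ q Hc Nw) as (z' & Iz' & _).
        rewrite Hr in Iz; rewrite E in Iz'.
        apply (Hd (step p (opp d))); rewrite !occupied_lay, !cells_trace; eauto.
    (* A partner would have to start with colour [c] or end with colour [a]. These are its possible
       end colours, and with [a], [b], [c] distinct none of them qualifies. *)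
    - assert (Hends : x = a /\ y = b \/ x = b /\ y = c \/ x = a /\ y = c).
      { assert (Huniq : forall w a1 d1 b1 e1 a2 d2 b2 e2, w <> [] ->
          chain a1 d1 w b1 e1 -> chain a2 d2 w b2 e2 -> a1 = a2 /\ b1 = b2).
        { clear; intros w; induction w as [| z w IH]; [congruence |].
          intros a1 d1 b1 e1 a2 d2 b2 e2 _ (H1 & H2 & H3) (K1 & K2 & K3).
          split; [congruence |].
          destruct w as [| z' w]; [destruct H3, K3; congruence |].
          eapply IH; eauto; discriminate. }
        destruct Hw as [-> | [-> | ->]].
        - left; eapply Huniq; eauto.
        - right; left; eapply Huniq; eauto.
        - right; right; eapply Huniq; eauto. }
      destruct (lay_link _ _ _ _ _ _ _ _ _ _ _ _ Hz Hc Hd Hb)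
        as [(_ & E & _) | (_ & E & _)]; intuition congruence. }
  assert (Hsel : forall p q w x g y h, chain x g w y h -> x <> y ->
    disjoint (lay p w) (lay q w) -> ~ bonded str (lay p w) (lay q w)).
  { intros p q w x g y h Hc Hxy Hd Hb.
    destruct (lay_link _ _ _ _ _ _ _ _ _ _ _ _ Hc Hc Hd Hb)
      as [(_ & E & _) | (_ & E & _)]; congruence. }
  set (Q := fun A => copies u A \/ copies v A \/ copies (u ++ v) A).
  assert (Hcomb : forall A B, Q A -> Q B -> combinable 1 str A B ->
    copies (u ++ v) (union A B) /\ ~ copies (u ++ v) A).
  { intros A B HA HB H; apply combinable_iff in H; destruct H as (Hd & _ & Hb).
    destruct HA as [[p ->] | [[p ->] | [p ->]]], HB as [[q ->] | [[q ->] | [q ->]]];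
      try (exfalso; eapply Hsel; [| | exact Hd | exact Hb]; eauto; fail);
      try (exfalso; eapply Hclosed; [| | exact Hd | exact Hb]; eauto; fail);
      try (exfalso; eapply Hclosed; [| | exact (disjoint_sym _ _ Hd) |
             exact (bonded_str_sym _ _ Hb)]; eauto; fail).
    - assert (E := Huv _ _ Hd Hb); subst q; split.
      + exists p; rewrite lay_app; auto.
      + intros [r Hr]; revert Hd Hb; rewrite Hr; intros Hd Hb.
        eapply Hclosed; [| | exact Hd | exact Hb]; eauto.
    - assert (E := Huv _ _ (disjoint_sym _ _ Hd) (bonded_str_sym _ _ Hb)); subst p; split.
      + exists q; rewrite union_comm, lay_app by exact Hd; auto.
      + intros [r Hr]; revert Hd Hb; rewrite Hr; intros Hd Hb.
        eapply Hclosed; [| | exact Hd | exact Hb]; eauto. }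
  assert (Hp : forall A, producible 1 str inp A -> Q A).
  { intros A HA; induction HA as [A HA | A w HA IH | A B HA IHA HB IHB H].
    - destruct (proj1 Hf A HA) as (tw' & [<- | [<- | []]] & H); unfold Q; auto.
    - unfold Q in *; destruct IH as [[p ->] | [[p ->] | [p ->]]];
        rewrite translate_lay; auto using copies_lay.
    - right; right; apply Hcomb; auto. }
  assert (Pu : forall p, producible 1 str inp (lay p u))
    by (intros; eapply feeds_producible; [exact Hf | simpl; auto]).
  assert (Pv : forall p, producible 1 str inp (lay p v))
    by (intros; eapply feeds_producible; [exact Hf | simpl; auto]).
  assert (J : forall p, combinable 1 str (lay p u) (lay (endp p (map ct_letter u)) v))
    by (intros; eapply lay_join; eauto).
  intros A; split.
  - intros [HA Ht]; destruct (Hp A HA) as [[p ->] | [[p ->] | H]]; [| | exact H]; exfalso.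
    + eapply Ht; [apply Pv | apply J].
    + destruct (endp_surj (map ct_letter u) p) as [q <-].
      apply (Ht (lay q u)); [apply Pu |].
      specialize (J q); rewrite combinable_iff in J |- *.
      destruct J as (J1 & _ & J2).
      split; [apply disjoint_sym; exact J1 |].
      split; [apply finite_lay | apply bonded_str_sym; exact J2].
  - intros [p ->]; split.
    + rewrite lay_app; apply prod_comb; auto.
    + intros B HB H.
      destruct (Hcomb (lay p (u ++ v)) B) as [_ Hno]; auto.
      * right; right; apply copies_lay.
      * apply Hno, copies_lay.
Qed.

(** * Flooding a ring *)

Lemma combinable_translate A B v :
  combinable 1 str A B -> combinable 1 str (translate A v) (translate B v).
Proof.
  rewrite !combinable_iff; intros (Hd & Hf & p & d & t & t' & HA & HB & H).
  split; [| split].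
  - intros q; apply (Hd (psub q v)).
  - apply finite_translate, Hf.
  - exists (padd p v), d, t, t'; unfold translate.
    rewrite step_psub, psub_padd; auto.
Qed.

(** Connectivity in the form of an induction principle. It is always applied to a set [S] that a
    neighbouring cell can leave only by running into another assembly. *)
Definition connected_asm (A : assembly) : Prop :=
  forall S : pos -> Prop,
    (forall q d, occupied A q -> occupied A (step q d) -> S q -> S (step q d)) ->
    forall q q', occupied A q -> occupied A q' -> S q -> S q'.

(** The coordinate in direction [d]. It serves as the termination measure of straight walks and for
    choosing extreme cells. *)
Definition height (d : dir) (q : pos) : Z :=
  fst q * fst (vec d) + snd q * snd (vec d).

Lemma height_step d q : height d (step q d) = height d q + 1.
Proof. unfold height; destruct d; pos_solve. Qed.

Lemma height_bounded d (L : list pos) :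
  exists N, forall q, In q L -> height d q < N.
Proof.
  induction L as [| p L [N HN]]; [exists 0; intros q [] |].
  exists (Z.max N (height d p + 1)); intros q [-> | Hq]; [lia |].
  specialize (HN q Hq); lia.
Qed.

Lemma height_max d (A : assembly) :
  finite_asm A -> (exists q, occupied A q) ->
  exists m, occupied A m /\ forall q, occupied A q -> height d q <= height d m.
Proof.
  intros Hf [q0 H0]; destruct (finite_asm_NoDup A Hf) as (L & _ & HL).
  assert (H : forall M, incl M L -> M <> [] ->
    exists m, In m M /\ forall q, In q M -> height d q <= height d m).
  { induction M as [| p M IH]; [congruence |]; intros Hi _.
    destruct M as [| p' M].
    { exists p; split; [simpl; auto |]; intros q [-> | []]; lia. }
    destruct IH as (m & Hm & Hmax); [intros q Hq; apply Hi; simpl in *; auto | discriminate |].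
    destruct (Z_le_gt_dec (height d p) (height d m)) as [h | h].
    - exists m; split; [right; exact Hm |]; intros q [-> | Hq]; auto.
    - exists p; split; [left; reflexivity |]; intros q [-> | Hq]; [lia |].
      specialize (Hmax q Hq); lia. }
  destruct (H L) as (m & Hm & Hmax).
  - intros q; auto.
  - apply HL in H0; intros ->; contradiction.
  - exists m; split; [apply HL, Hm |]; intros q Hq; apply Hmax, HL, Hq.
Qed.

(** All that the flooding argument needs to know about a ring [R] and its interior [I]. [enc_closed]
    says that the interior can be left only through the ring. The last two fields make the ring
    sticky towards the interior and inert towards the outside. *)
Record encloses (R : assembly) (I : pos -> bool) : Prop := {
  enc_ring_finite : finite_asm R;
  enc_ring_nonempty : exists q, occupied R q;
  enc_ring_connected : connected_asm R;
  enc_inside_finite : exists L, forall q, I q = true -> In q L;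
  enc_disjoint : forall q, I q = true -> R q = None;
  enc_closed : forall q d, I q = true ->
    I (step q d) = true \/ occupied R (step q d);
  enc_inner : forall q t d, R q = Some t -> I (step q d) = true ->
    side t d = inner_glue;
  enc_outer : forall q t d, R q = Some t -> I (step q d) = false ->
    ~ occupied R (step q d) -> side t d = 0%nat }.

Definition fill (R : assembly) (X : pos -> bool) : assembly :=
  fun q => match R q with
           | Some t => Some t
           | None => if X q then Some filler else None
           end.

Definition loose (A : assembly) : Prop :=
  (forall q t, A q = Some t -> t = filler) /\ finite_asm A /\
  (exists q, occupied A q) /\ connected_asm A.

Lemma loose_single p : loose (translate (single filler) p).
Proof.
  assert (H : forall q t, translate (single filler) p q = Some t ->
            q = p /\ t = filler).
  { intros q t E; apply single_some in E; destruct E as [E ->]; split; [| auto].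
    pos_solve. }
  split; [| split; [| split]].
  - intros q t E; apply (H q t E).
  - exists [p]; intros q Hq; apply occupied_ex in Hq; destruct Hq as [t E].
    left; symmetry; apply (H q t E).
  - exists p; apply (occupied_some _ _ filler); apply single_some; split; [| auto].
    pos_solve.
  - intros S _ q q' Hq Hq'; apply occupied_ex in Hq, Hq'.
    destruct Hq as [t E], Hq' as [t' E'].
    destruct (H _ _ E) as [-> _], (H _ _ E') as [-> _]; auto.
Qed.

Lemma loose_translate A v : loose A -> loose (translate A v).
Proof.
  intros (H1 & H2 & (q0 & H3) & H4); split; [| split; [| split]].
  - intros q t; apply H1.
  - apply finite_translate, H2.
  - exists (padd q0 v); unfold occupied, translate; rewrite psub_padd; exact H3.
  - intros S HS q q' Hq Hq' Sq.
    rewrite <- (padd_psub q' v).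
    apply (H4 (fun r => S (padd r v))) with (q := psub q v).
    + intros r d Hr Hr' Sr.
      replace (padd (step r d) v) with (step (padd r v) d) by (destruct d; pos_solve).
      apply HS; [| | exact Sr]; unfold occupied, translate; rewrite ?step_psub, psub_padd; auto.
    + exact Hq.
    + exact Hq'.
    + rewrite padd_psub; exact Sq.
Qed.

Lemma connected_union A B :
  connected_asm A -> connected_asm B -> bonded str A B -> connected_asm (union A B).
Proof.
  intros HA HB (p & d & t & t' & Ep & Eq & _) S HS.
  assert (Op := occupied_some _ _ _ Ep); assert (Oq := occupied_some _ _ _ Eq).
  assert (SA : forall q q', occupied A q -> occupied A q' -> S q -> S q').
  { apply HA; intros r f Hr Hr'; apply HS; apply occupied_union; auto. }
  assert (SB : forall q q', occupied B q -> occupied B q' -> S q -> S q').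
  { apply HB; intros r f Hr Hr'; apply HS; apply occupied_union; auto. }
  assert (Sd : S p -> S (step p d)).
  { apply HS; apply occupied_union; auto. }
  assert (Su : S (step p d) -> S p).
  { intros H; rewrite <- (step_opp p d).
    apply HS; [| | exact H]; rewrite ?step_opp; apply occupied_union; auto. }
  intros q q' Hq Hq' Sq; apply occupied_union in Hq, Hq'.
  destruct Hq as [Hq | Hq], Hq' as [Hq' | Hq']; eauto.
Qed.

Lemma loose_union A B : loose A -> loose B -> bonded str A B -> loose (union A B).
Proof.
  intros (A1 & A2 & (q & A3) & A4) (B1 & B2 & B3 & B4) Hb; split; [| split; [| split]].
  - intros r t; unfold union; destruct (A r) eqn:E; [intros [= <-] |]; eauto.
  - apply finite_union; auto.
  - exists q; apply occupied_union; auto.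
  - apply connected_union; auto.
Qed.

Section Filling.

Context (R : assembly) (I : pos -> bool) (H : encloses R I).

Definition inside (X : pos -> bool) : Prop := forall q, X q = true -> I q = true.

Lemma occupied_fill X q : occupied (fill R X) q <-> occupied R q \/ X q = true.
Proof.
  unfold occupied, fill; destruct (R q), (X q); intuition congruence.
Qed.

Lemma finite_fill X : inside X -> finite_asm (fill R X).
Proof.
  intros HX; destruct (enc_ring_finite _ _ H) as [L HL].
  destruct (enc_inside_finite _ _ H) as [M HM].
  exists (L ++ M); intros q Hq; apply in_or_app.
  apply occupied_fill in Hq; destruct Hq; auto.
Qed.

Lemma fill_disjoint_ring X Y v w p :
  disjoint (translate (fill R X) v) (translate (fill R Y) w) ->
  occupied R (psub p v) -> occupied R (psub p w) -> False.
Proof.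
  intros Hd Hv Hw; apply (Hd p); split; apply occupied_fill; auto.
Qed.

(** The outward sides of the ring are null, and a filler in the interior has only interior or ring
    cells as neighbours. Any bond to something disjoint therefore reaches a cell of the interior. *)
Lemma fill_bonds_inside X v B :
  inside X -> disjoint (translate (fill R X) v) B ->
  bonded str (translate (fill R X) v) B ->
  exists q, occupied B q /\ I (psub q v) = true.
Proof.
  intros HX Hd (p & d & t & t' & Ep & Eq & Hs).
  assert (Oq := occupied_some _ _ _ Eq).
  exists (step p d); split; [exact Oq |].
  assert (Hn : ~ occupied (translate (fill R X) v) (step p d)).
  { intros Ho; apply (Hd (step p d)); auto. }
  assert (Hn' : ~ occupied R (step (psub p v) d)).
  { intros Ho; apply Hn; apply occupied_fill; rewrite step_psub; auto. }
  rewrite step_psub.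
  unfold translate, fill in Ep; destruct (R (psub p v)) as [u |] eqn:Eu.
  - destruct (I (step (psub p v) d)) eqn:Ei; [reflexivity |].
    injection Ep as ->; rewrite (enc_outer _ _ H _ _ _ Eu Ei Hn') in Hs; simpl in Hs; lia.
  - destruct (X (psub p v)) eqn:Ex; [| discriminate].
    destruct (enc_closed _ _ H _ d (HX _ Ex)); [auto | contradiction].
Qed.

(** Walking from an interior cell in direction [d] must end, as the interior is finite, and it can
    end only at the ring, which is strictly higher. *)
Lemma inside_below d m :
  (forall q, occupied R q -> height d q <= height d m) ->
  forall q, I q = true -> height d q < height d m.
Proof.
  intros Hm; destruct (enc_inside_finite _ _ H) as [L HL].
  destruct (height_bounded d L) as [N HN].
  assert (Hk : forall k q, (Z.to_nat (N - height d q) <= k)%nat -> I q = true ->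
    height d q < height d m).
  { induction k as [| k IH]; intros q Hk Hq; assert (Hb := HN q (HL q Hq)); [lia |].
    destruct (enc_closed _ _ H q d Hq) as [Hi | Ho].
    - apply IH in Hi; rewrite height_step in *; lia.
    - apply Hm in Ho; rewrite height_step in Ho; lia. }
  intros q; apply (Hk _ q (le_n _)).
Qed.

(** If the ring shifted by [v] lay in the interior shifted by [w], its highest cell in each
    direction [d] would lie below that of the other ring. So [v - w] would have negative height both
    to the east and to the west. *)
Lemma ring_not_inside v w :
  ~ forall q, occupied R (psub q v) -> I (psub q w) = true.
Proof.
  intros Hi.
  assert (Hneg : forall d, height d (psub v w) < 0).
  { intros d; destruct (height_max d R (enc_ring_finite _ _ H) (enc_ring_nonempty _ _ H))
      as (m & Hm & Hmax).
    specialize (Hi (padd m v)); rewrite psub_padd in Hi.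
    assert (Hb := inside_below d m Hmax _ (Hi Hm)).
    unfold height in *; pos_solve. }
  assert (H1 := Hneg DE); assert (H2 := Hneg DW).
  unfold height in *; pos_solve.
Qed.

(** A ring with one cell in the interior of another cannot leave that interior without meeting the
    other ring. Being connected it would lie there completely, against [ring_not_inside]. *)
Lemma ring_avoids_inside X Y v w q :
  disjoint (translate (fill R X) v) (translate (fill R Y) w) ->
  occupied R (psub q v) -> I (psub q w) = true -> False.
Proof.
  intros Hd Hq Hi; apply (ring_not_inside v w); intros q' Hq'.
  rewrite <- (padd_psub q' v).
  apply (enc_ring_connected _ _ H (fun r => I (psub (padd r v) w) = true))
    with (q := psub q v); auto; [| rewrite padd_psub; exact Hi].
  intros r d Hr Hr' Ir.
  replace (psub (padd (step r d) v) w) with (step (psub (padd r v) w) d)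
    by (destruct d; pos_solve).
  destruct (enc_closed _ _ H _ d Ir) as [? | Ho]; [auto | exfalso].
  apply (fill_disjoint_ring X Y v w (padd (step r d) v) Hd).
  - rewrite psub_padd; exact Hr'.
  - replace (psub (padd (step r d) v) w) with (step (psub (padd r v) w) d)
      by (destruct d; pos_solve).
    exact Ho.
Qed.

(** Walking east from a common interior cell, one of the two rings is met
    first, and it is met inside the other one. *)
Lemma insides_avoid X Y v w q :
  disjoint (translate (fill R X) v) (translate (fill R Y) w) ->
  I (psub q v) = true -> I (psub q w) = true -> False.
Proof.
  intros Hd; destruct (enc_inside_finite _ _ H) as [L HL].
  destruct (height_bounded DE L) as [N HN].
  remember (Z.to_nat (N - height DE (psub q v))) as k eqn:Hk.
  assert (Hk' : (Z.to_nat (N - height DE (psub q v)) <= k)%nat) by lia; clear Hk.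
  revert q Hk'; induction k as [| k IH]; intros q Hk Hv Hw;
    assert (Hb := HN _ (HL _ Hv)); [lia |].
  destruct (enc_closed _ _ H _ DE Hv) as [Iv | Ov], (enc_closed _ _ H _ DE Hw) as [Iw | Ow];
    rewrite <- step_psub in *.
  - apply (IH (step q DE)); auto.
    rewrite step_psub, height_step; lia.
  - eapply ring_avoids_inside; [apply disjoint_sym; exact Hd | exact Ow | exact Iv].
  - eapply ring_avoids_inside; [exact Hd | exact Ov | exact Iw].
  - eapply fill_disjoint_ring; eauto.
Qed.

(** A bond puts a cell of the second ring or of its filling into the first interior. The former is
    excluded by [ring_avoids_inside], the latter, where both interiors meet, by [insides_avoid]. *)
Lemma rings_clash X Y v w :
  inside X -> inside Y ->
  disjoint (translate (fill R X) v) (translate (fill R Y) w) ->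
  ~ bonded str (translate (fill R X) v) (translate (fill R Y) w).
Proof.
  intros HX HY Hd Hb.
  destruct (fill_bonds_inside X v _ HX Hd Hb) as (q & Hq & Hi).
  apply occupied_fill in Hq; destruct Hq as [Hq | Hq].
  - eapply ring_avoids_inside; [apply disjoint_sym; exact Hd | exact Hq | exact Hi].
  - eapply insides_avoid; [exact Hd | exact Hi | apply HY, Hq].
Qed.

(** The bond puts one cell of [B] in the interior, and a connected supertile cannot cross the
    ring. *)
Lemma loose_goes_inside X v B :
  inside X -> loose B -> disjoint (translate (fill R X) v) B ->
  bonded str (translate (fill R X) v) B ->
  forall q, occupied B q -> I (psub q v) = true.
Proof.
  intros HX (_ & _ & _ & Hc) Hd Hb.
  destruct (fill_bonds_inside X v B HX Hd Hb) as (q & Hq & Hi).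
  intros q' Hq'; apply (Hc (fun r => I (psub r v) = true)) with (q := q); auto.
  intros r d Hr Hr' Ir; rewrite step_psub.
  destruct (enc_closed _ _ H _ d Ir) as [? | Ho]; [auto | exfalso].
  apply (Hd (step r d)); split; [| exact Hr'].
  apply occupied_fill; rewrite step_psub; auto.
Qed.

Lemma absorb_loose X v B :
  inside X -> loose B -> disjoint (translate (fill R X) v) B ->
  bonded str (translate (fill R X) v) B ->
  exists Y, inside Y /\ union (translate (fill R X) v) B = translate (fill R Y) v.
Proof.
  intros HX HB Hd Hb.
  assert (Hi := loose_goes_inside X v B HX HB Hd Hb).
  exists (fun q => X q || if occupied_dec B (padd q v) then true else false); split.
  - intros q Hq; apply orb_true_iff in Hq; destruct Hq as [Hq | Hq]; [auto |].
    destruct (occupied_dec B (padd q v)) as [Ho |]; [| discriminate].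
    specialize (Hi _ Ho); rewrite psub_padd in Hi; exact Hi.
  - extensionality q; unfold union, translate, fill; rewrite padd_psub.
    destruct (R (psub q v)); [reflexivity |].
    destruct (X (psub q v)); simpl; [reflexivity |].
    destruct (occupied_dec B q) as [Ho | Ho].
    + apply occupied_ex in Ho; destruct Ho as [t Ht]; rewrite Ht; f_equal.
      apply (proj1 HB _ _ Ht).
    + unfold occupied in Ho; destruct (B q); [exfalso; apply Ho; discriminate | reflexivity].
Qed.

Definition grown (A : assembly) : Prop :=
  loose A \/ exists v X, inside X /\ A = translate (fill R X) v.

Lemma grown_combine A B : grown A -> grown B -> combinable 1 str A B -> grown (union A B).
Proof.
  intros HA HB HC; apply combinable_iff in HC; destruct HC as (Hd & _ & Hb).
  destruct HA as [HA | (v & X & HX & ->)], HB as [HB | (w & Y & HY & ->)].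
  - left; apply loose_union; auto.
  - right; rewrite union_comm by exact Hd.
    destruct (absorb_loose Y w A HY HA (disjoint_sym _ _ Hd) (bonded_str_sym _ _ Hb))
      as (Z & HZ & E); eauto.
  - right; destruct (absorb_loose X v B HX HB Hd Hb) as (Z & HZ & E); eauto.
  - exfalso; eapply rings_clash; [| | exact Hd | exact Hb]; auto.
Qed.

(** Going east from an empty interior cell, the last empty one before the ring or a filler is a free
    place with something to stick to. *)
Lemma fill_grows X q0 :
  inside X -> I q0 = true -> X q0 = false ->
  exists q, I q = true /\ X q = false /\
    combinable 1 str (fill R X) (translate (single filler) q).
Proof.
  intros HX; destruct (enc_inside_finite _ _ H) as [L HL].
  destruct (height_bounded DE L) as [N HN].
  remember (Z.to_nat (N - height DE q0)) as k eqn:Hk.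
  assert (Hk' : (Z.to_nat (N - height DE q0) <= k)%nat) by lia; clear Hk.
  revert q0 Hk'; induction k as [| k IH]; intros q Hk Hq Xq;
    assert (Hb := HN _ (HL _ Hq)); [lia |].
  destruct (I (step q DE) && negb (X (step q DE))) eqn:E.
  - apply andb_true_iff in E; destruct E as [E1 E2]; apply negb_true_iff in E2.
    apply (IH (step q DE)); auto; rewrite height_step; lia.
  - exists q; split; [exact Hq |]; split; [exact Xq |].
    apply combinable_iff; split; [| split; [apply finite_fill, HX |]].
    + intros p [Hp Hp']; apply occupied_ex in Hp'; destruct Hp' as [t Ht].
      apply single_some in Ht; destruct Ht as [Ht _].
      assert (p = q) by pos_solve; subst p.
      apply occupied_fill in Hp; unfold occupied in Hp.
      rewrite (enc_disjoint _ _ H q Hq), Xq in Hp; intuition congruence.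
    + assert (Hs : translate (single filler) q (step (step q DE) (opp DE)) = Some filler).
      { rewrite step_opp; apply single_some; split; [pos_solve | reflexivity]. }
      destruct (R (step q DE)) as [t |] eqn:Et.
      * exists (step q DE), (opp DE), t, filler; split; [| split; [exact Hs |]].
        -- unfold fill; rewrite Et; reflexivity.
        -- rewrite side_filler, (enc_inner _ _ H _ _ (opp DE) Et);
             [simpl; lia | rewrite step_opp; exact Hq].
      * assert (Xe : X (step q DE) = true).
        { destruct (enc_closed _ _ H q DE Hq) as [Hi | Ho].
          - rewrite Hi in E; simpl in E; apply negb_false_iff in E; exact E.
          - unfold occupied in Ho; congruence. }
        exists (step q DE), (opp DE), filler, filler; split; [| split; [exact Hs |]].
        -- unfold fill; rewrite Et, Xe; reflexivity.
        -- simpl; lia.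
Qed.

Context (inp : assembly -> Prop)
  (Hinp : forall A, inp A -> A = single filler \/ exists v, A = translate R v)
  (Hfil : inp (single filler)) (Hring : exists v, inp (translate R v)).

Lemma producible_ring : producible 1 str inp R.
Proof.
  destruct Hring as [v0 Hv0].
  replace R with (translate (translate R v0) (psub (0, 0) v0)).
  - apply prod_tr, prod_in, Hv0.
  - rewrite translate_translate; replace (padd v0 (psub (0, 0) v0)) with (0, 0) by pos_solve.
    apply translate_0.
Qed.

Lemma producible_filler q : producible 1 str inp (translate (single filler) q).
Proof. apply prod_tr, prod_in, Hfil. Qed.

Lemma fill_empty : fill R (fun _ => false) = R.
Proof. extensionality q; unfold fill; destruct (R q); reflexivity. Qed.

Lemma producible_grown A : producible 1 str inp A -> grown A.
Proof.
  intros HA; induction HA as [A HA | A v HA IH | A B HA IHA HB IHB HC].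
  - destruct (Hinp A HA) as [-> | [v ->]].
    + left; rewrite <- (translate_0 (single filler)); apply loose_single.
    + right; exists v, (fun _ => false); split; [discriminate |].
      rewrite fill_empty; reflexivity.
  - destruct IH as [IH | (w & X & HX & ->)].
    + left; apply loose_translate, IH.
    + right; exists (padd w v), X; split; [exact HX | apply translate_translate].
  - apply grown_combine; auto.
Qed.

Lemma producible_fill X : inside X -> producible 1 str inp (fill R X) ->
  producible 1 str inp (fill R I).
Proof.
  destruct (enc_inside_finite _ _ H) as [L HL].
  remember (length (filter (fun q => negb (X q)) L)) as k eqn:Hk.
  assert (Hk' : (length (filter (fun q => negb (X q)) L) <= k)%nat) by lia; clear Hk.
  revert X Hk'; induction k as [| k IH]; intros X Hk HX Hp.
  all: destruct (classic (exists q0, I q0 = true /\ X q0 = false)) as [(q0 & H1 & H2) | Hn];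
    [| replace I with X; [exact Hp |]; extensionality q; destruct (I q) eqn:Eq;
       [destruct (X q) eqn:Ex; [auto | exfalso; eauto] |
        destruct (X q) eqn:Ex; [apply HX in Ex; congruence | auto]]].
  - assert (Hin : In q0 (filter (fun q => negb (X q)) L)).
    { apply filter_In; rewrite H2; auto. }
    destruct (filter (fun q => negb (X q)) L); [contradiction | simpl in Hk; lia].
  - destruct (fill_grows X q0 HX H1 H2) as (q & Iq & Xq & Hc).
    set (Y := fun p => X p || if pos_eq_dec p q then true else false).
    assert (E : union (fill R X) (translate (single filler) q) = fill R Y).
    { extensionality p; unfold union, fill, Y, translate.
      destruct (R p); [reflexivity |]; destruct (X p); [reflexivity |]; simpl.
      destruct (pos_eq_dec p q) as [-> | n].
      - apply single_some; split; [pos_solve | reflexivity].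
      - destruct (single filler (psub p q)) eqn:Es; [| reflexivity].
        apply single_some in Es; destruct Es as [Es _].
        exfalso; apply n; pos_solve. }
    apply (IH Y).
    + assert (Hlt : forall M, In q M ->
        (length (filter (fun p => negb (Y p)) M) < length (filter (fun p => negb (X p)) M))%nat).
      { assert (Hle : forall M,
          (length (filter (fun p => negb (Y p)) M) <= length (filter (fun p => negb (X p)) M))%nat).
        { induction M as [| p M IHM]; simpl; [lia |]; unfold Y at 1.
          destruct (X p); simpl; [lia |].
          destruct (pos_eq_dec p q); simpl; lia. }
        induction M as [| p M IHM]; [intros [] |]; simpl; intros [-> | Hp'].
        - unfold Y at 1; rewrite Xq; simpl; destruct (pos_eq_dec q q); [| congruence].
          simpl; specialize (Hle M); lia.
        - specialize (IHM Hp'); unfold Y at 1; destruct (X p); simpl; [lia |].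
          destruct (pos_eq_dec p q); simpl; lia. }
      specialize (Hlt L (HL q Iq)); lia.
    + intros p Hp'; unfold Y in Hp'; apply orb_true_iff in Hp'.
      destruct Hp' as [? | Hp']; [auto |].
      destruct (pos_eq_dec p q) as [-> |]; [exact Iq | discriminate].
    + rewrite <- E; apply prod_comb; auto using producible_filler.
Qed.

Lemma fill_bin A : terminal 1 str inp A <-> exists v, A = translate (fill R I) v.
Proof.
  assert (HI : inside I) by (intros q; auto).
  split.
  - intros [HA Ht]; destruct (producible_grown A HA) as [Hl | (v & X & HX & ->)].
    + exfalso; destruct Hl as (L1 & L2 & L3 & L4).
      (* The place east of an easternmost cell is free, so one more filler always attaches there. *)
      destruct (height_max DE A L2 L3) as (m & Hm & Hmax).
      apply (Ht _ (producible_filler (step m DE))).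
      apply combinable_iff; split; [| split; [exact L2 |]].
      * intros p [Hp Hp']; apply occupied_ex in Hp'; destruct Hp' as [t Hp'].
        apply single_some in Hp'; destruct Hp' as [Hp' _].
        assert (p = step m DE) by pos_solve; subst p.
        apply Hmax in Hp; rewrite height_step in Hp; lia.
      * apply occupied_ex in Hm; destruct Hm as [t Hm].
        exists m, DE, t, filler; split; [exact Hm |]; split.
        -- apply single_some; split; [pos_solve | reflexivity].
        -- rewrite (L1 _ _ Hm); simpl; lia.
    + exists v; f_equal; f_equal; extensionality q.
      destruct (I q) eqn:Iq.
      * destruct (X q) eqn:Xq; [reflexivity | exfalso].
        destruct (fill_grows X q HX Iq Xq) as (r & _ & _ & Hc).
        apply combinable_translate with (v := v) in Hc.
        rewrite translate_translate in Hc.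
        eapply Ht; [| exact Hc]; apply producible_filler.
      * destruct (X q) eqn:Xq; [apply HX in Xq; congruence | reflexivity].
  - intros [v ->]; split.
    + apply prod_tr; apply (producible_fill (fun _ => false)); [discriminate |].
      rewrite fill_empty; apply producible_ring.
    + intros B HB HC; apply combinable_iff in HC; destruct HC as (Hd & _ & Hb).
      destruct (producible_grown B HB) as [Hl | (w & X & HX & ->)].
      (* A bond must reach into the interior, and there every cell is taken. *)
      * destruct (fill_bonds_inside I v B HI Hd Hb) as (q & Hq & Hi).
        apply (Hd q); split; [apply occupied_fill; auto | exact Hq].
      * eapply rings_clash; [| | exact Hd | exact Hb]; auto.
Qed.

End Filling.

(** * Assembling a straight-line program *)

Definition third (a c : color) : color :=
  match a, c with
  | C0, C1 | C1, C0 | C1, C1 => C2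
  | C0, C2 | C2, C0 | C0, C0 => C1
  | C1, C2 | C2, C1 | C2, C2 => C0
  end.

Lemma third_l a c : a <> third a c.
Proof. destruct a, c; discriminate. Qed.

Lemma third_r a c : third a c <> c.
Proof. destruct a, c; discriminate. Qed.

Fixpoint linked (d : dir) (w : list letter) (e : dir) : Prop :=
  match w with
  | [] => d = e
  | l :: w' => fst l = d /\ linked (snd l) w' e
  end.

Lemma linked_app d u v e :
  linked d (u ++ v) e -> exists m, linked d u m /\ linked m v e.
Proof.
  revert d; induction u as [| l u IH]; simpl; intros d; [eauto |].
  intros [E H]; destruct (IH _ H) as (m & Hu & Hv); eauto.
Qed.

Definition simple (w : list letter) : Prop := forall p, NoDup (cells p w).

Definition no_uturn (w : list letter) : Prop :=
  forall l, In l w -> snd l <> opp (fst l).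

Lemma simple_app u v : simple (u ++ v) -> simple u /\ simple v.
Proof.
  intros H; split; intros p.
  - specialize (H p); rewrite cells_app in H; eapply NoDup_app_remove_r; exact H.
  - destruct (endp_surj u p) as [q <-]; specialize (H q).
    rewrite cells_app in H; eapply NoDup_app_remove_l; exact H.
Qed.

Definition good (w : list letter) : Prop :=
  simple w /\ no_uturn w /\ exists d e, linked d w e.

Lemma good_app u v : good (u ++ v) -> good u /\ good v.
Proof.
  intros (H1 & H2 & d & e & H3); apply simple_app in H1; apply linked_app in H3.
  destruct H1 as [Su Sv], H3 as (m & Lu & Lv).
  repeat split; eauto; intros l Hl; apply H2, in_or_app; auto.
Qed.

Definition code (c : color) : nat := match c with C0 => 0 | C1 => 1 | C2 => 2 end.
Definition decode (n : nat) : color :=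
  match n with O => C0 | 1%nat => C1 | _ => C2 end.

(** Nine bins for each slot of the program, indexed by the head and tail colour with which its word
    is coloured. *)
Definition bin_of (i : nat) (a c : color) : nat := (9 * i + (3 * code a + code c))%nat.
Definition bin_slot (j : nat) : nat := (j / 9)%nat.
Definition bin_head (j : nat) : color := decode ((j mod 9) / 3).
Definition bin_tail (j : nat) : color := decode ((j mod 9) mod 3).

Lemma bin_of_spec i a c :
  bin_slot (bin_of i a c) = i /\ bin_head (bin_of i a c) = a /\ bin_tail (bin_of i a c) = c.
Proof.
  assert (Hk : (3 * code a + code c < 9)%nat) by (destruct a, c; simpl; lia).
  unfold bin_slot, bin_head, bin_tail, bin_of.
  rewrite <- (Nat.mod_unique (9 * i + (3 * code a + code c)) 9 i (3 * code a + code c)) by lia.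
  rewrite <- (Nat.div_unique (9 * i + (3 * code a + code c)) 9 i (3 * code a + code c)) by lia.
  destruct a, c; auto.
Qed.

Lemma bin_of_lt i a c B : (i < B)%nat -> (bin_of i a c < 9 * B)%nat.
Proof. unfold bin_of; destruct a, c; simpl; lia. Qed.

(** A straight-line program in levels: slot [i] of level [0] holds the word
    [base i]; slot [i] of level [s + 1] holds the concatenation of the words of
    two slots of level [s], [None] standing for the empty word. *)
Section Program.

Context (base : nat -> option letter) (prog : nat -> nat -> option nat * option nat).

Definition get (w : nat -> list letter) (o : option nat) : list letter :=
  match o with Some j => w j | None => [] end.

Fixpoint word (s i : nat) : list letter :=
  match s with
  | O => match base i with Some l => [l] | None => [] end
  | S s' => get (word s') (fst (prog s' i)) ++ get (word s') (snd (prog s' i))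
  end.

(** An empty word has no supertile, so a concatenation with an empty factor must become a plain
    transfer of the other factor. This filter singles out the factors that are really present. *)
Definition live (s : nat) (o : option nat) : option nat :=
  match o with
  | Some j => match word s j with [] => None | _ => Some j end
  | None => None
  end.

Lemma live_none s o : live s o = None -> get (word s) o = [].
Proof.
  destruct o as [j |]; simpl; [destruct (word s j); [auto | discriminate] | auto].
Qed.

Lemma live_some s o j :
  live s o = Some j -> o = Some j /\ get (word s) o = word s j /\ word s j <> [].
Proof.
  destruct o as [k |]; simpl; [| discriminate].
  destruct (word s k) eqn:E; [discriminate |]; intros [= <-]; rewrite E.
  repeat split; discriminate.
Qed.

(** The colouring is inherited from the way the word is put together: each join with outer colours
    [a] and [c] uses the third colour at its seam. *)
Fixpoint tiling (s i : nat) (a c : color) : list ctile :=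
  match s with
  | O => match base i with Some l => [CT (fst l) (snd l) a c] | None => [] end
  | S s' =>
      match live s' (fst (prog s' i)), live s' (snd (prog s' i)) with
      | None, None => []
      | Some j, None | None, Some j => tiling s' j a c
      | Some j, Some j' => tiling s' j a (third a c) ++ tiling s' j' (third a c) c
      end
  end.

Lemma word_S s i :
  word (S s) i =
  match live s (fst (prog s i)), live s (snd (prog s i)) with
  | None, None => []
  | Some j, None | None, Some j => word s j
  | Some j, Some j' => word s j ++ word s j'
  end.
Proof.
  simpl.
  destruct (live s (fst (prog s i))) as [j |] eqn:E1;
    destruct (live s (snd (prog s i))) as [j' |] eqn:E2;
    try apply live_none in E1; try apply live_none in E2;
    try apply live_some in E1; try apply live_some in E2;
    repeat match goal with H : _ /\ _ |- _ => destruct H end;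
    repeat match goal with H : get _ _ = _ |- _ => rewrite H end;
    rewrite ?app_nil_r; auto.
Qed.

Lemma map_letter_tiling s i a c : map ct_letter (tiling s i a c) = word s i.
Proof.
  revert i a c; induction s as [| s IH]; intros i a c.
  - simpl; destruct (base i) as [[d e] |]; reflexivity.
  - rewrite word_S; cbn [tiling].
    destruct (live s (fst (prog s i))), (live s (snd (prog s i)));
      rewrite ?map_app, ?IH; auto.
Qed.

Lemma tiling_nonempty s i a c : word s i <> [] -> tiling s i a c <> [].
Proof. rewrite <- (map_letter_tiling s i a c); intros H E; rewrite E in H; auto. Qed.

Lemma chain_tiling s i a c d e :
  word s i <> [] -> linked d (word s i) e -> chain a d (tiling s i a c) c e.
Proof.
  revert i a c d e; induction s as [| s IH]; intros i a c d e.
  - simpl; destruct (base i) as [[x y] |]; [| congruence]; simpl.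
    intros _ [-> ->]; auto.
  - rewrite word_S; cbn [tiling].
    destruct (live s (fst (prog s i))) as [j |] eqn:E1;
      destruct (live s (snd (prog s i))) as [j' |] eqn:E2; intros Hne Hl;
      [| apply IH; auto | apply IH; auto | congruence].
    apply live_some in E1, E2; apply linked_app in Hl; destruct Hl as (m & H1 & H2).
    eapply chain_app; apply IH; eauto; tauto.
Qed.

Context (L B : nat) (Bpos : (0 < B)%nat)
  (Hprog : forall s i j,
     fst (prog s i) = Some j \/ snd (prog s i) = Some j -> (j < B)%nat)
  (zi zo : dir).

Definition base_tiles (j : nat) : list tile :=
  match base (bin_slot j) with
  | Some l => [ct_tile (CT (fst l) (snd l) (bin_head j) (bin_tail j))]
  | None => []
  end.

Definition join_bins (s i : nat) (a c : color) : list nat :=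
  match live s (fst (prog s i)), live s (snd (prog s i)) with
  | None, None => []
  | Some j, None | None, Some j => [bin_of j a c]
  | Some j, Some j' => [bin_of j a (third a c); bin_of j' (third a c) c]
  end.

(** The open path is coloured from [C0] to [C1]; this cell leads back from [C1] to [C0]. *)
Definition closing : ctile := CT zi zo C1 C0.

(** Stages 0 to [L] run the program. Stage [L + 1] adds the closing cell and stage [L + 2] the
    fillers, both in bin 0. *)
Definition stage_tiles (s j : nat) : list tile :=
  if Nat.eqb s 0 then (if Nat.ltb j (9 * B) then base_tiles j else [])
  else if Nat.eqb j 0 then
    (if Nat.eqb s (L + 1) then [ct_tile closing]
     else if Nat.eqb s (L + 2) then [filler] else [])
  else [].

Definition stage_mix (s j : nat) : list nat :=
  match s with
  | O => []
  | S s' =>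
      if Nat.ltb s' L then
        (if Nat.ltb j (9 * B) then join_bins s' (bin_slot j) (bin_head j) (bin_tail j)
         else [])
      else if Nat.eqb j 0 then
        (if Nat.eqb s' L then [bin_of 0 C0 C1]
         else if Nat.eqb s' (L + 1) then [0%nat] else [])
      else []
  end.

Definition program_system : system :=
  mkSystem str (L + 3) (9 * B) stage_tiles stage_mix [0%nat].

Lemma join_bins_lt s i a c j : In j (join_bins s i a c) -> (j < 9 * B)%nat.
Proof.
  unfold join_bins.
  destruct (live s (fst (prog s i))) as [k |] eqn:E1;
    destruct (live s (snd (prog s i))) as [k' |] eqn:E2;
    try apply live_some in E1; try apply live_some in E2; simpl; intros Hj;
    repeat match goal with H : _ /\ _ |- _ => destruct H | H : _ \/ _ |- _ => destruct H end;
    subst; try contradiction; apply bin_of_lt; eapply Hprog; eauto.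
Qed.

Lemma program_system_valid : valid_system 1 program_system.
Proof.
  split; [exact str_valid |]; cbn [program_system sys_stages sys_bins sys_tiles sys_mix sys_out].
  split; [lia |]; split; [| split; [| split]].
  - intros s j Hsj; unfold stage_tiles, stage_mix; split.
    + destruct (Nat.eqb_spec s 0), (Nat.ltb_spec j (9 * B)), (Nat.eqb_spec j 0),
        (Nat.eqb_spec s (L + 1)), (Nat.eqb_spec s (L + 2)); auto; lia.
    + destruct s as [| s]; [reflexivity |].
      destruct (Nat.ltb_spec s L), (Nat.ltb_spec j (9 * B)), (Nat.eqb_spec j 0),
        (Nat.eqb_spec s L), (Nat.eqb_spec s (L + 1)); auto; lia.
  - reflexivity.
  - intros [| s] j j'; unfold stage_mix; [intros [] |].
    destruct (Nat.ltb s L), (Nat.ltb j (9 * B)), (Nat.eqb j 0),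
      (Nat.eqb s L), (Nat.eqb s (L + 1)); simpl; try tauto;
      try apply join_bins_lt; intros [<- | []]; try lia; apply bin_of_lt; lia.
  - intros j [<- | []]; lia.
Qed.

Lemma stage_tiles_cases s j t : In t (stage_tiles s j) ->
  t = filler \/ exists d e a c, t = ct_tile (CT d e a c).
Proof.
  unfold stage_tiles, base_tiles.
  destruct (Nat.eqb s 0), (Nat.ltb j (9 * B)), (Nat.eqb j 0),
    (Nat.eqb s (L + 1)), (Nat.eqb s (L + 2)), (base (bin_slot j));
    simpl; intros Ht; try tauto; destruct Ht as [<- | []]; unfold closing; eauto 8.
Qed.

Lemma program_system_glues : glue_complexity_le program_system 18.
Proof.
  (* Six joint glues, the filler glue and the inner glue; eight are within the allowed eighteen. *)
  exists [1; 2; 3; 4; 5; 6; 7; 8]%nat; split; [simpl; lia |].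
  intros s j t g Ht Hg Hg0.
  assert (Hd : exists d, g = side t d).
  { destruct Hg as [<- | [<- | [<- | [<- | []]]]];
      [exists DN | exists DE | exists DS | exists DW]; reflexivity. }
  destruct Hd as [f ->].
  destruct (stage_tiles_cases s j t Ht) as [-> | (d & e & a & c & ->)].
  - rewrite side_filler; simpl; tauto.
  - rewrite side_ct_tile in *.
    destruct (ct_side_cases (CT d e a c) f) as [[_ E] | [[_ E] | [E | E]]];
      rewrite E in *; try congruence; destruct a, c; simpl; tauto.
Qed.

Definition all_dirs := [DN; DE; DS; DW].
Definition all_colors := [C0; C1; C2].

Definition all_tiles : list tile :=
  filler :: map (fun x => ct_tile (CT (fst (fst x)) (snd (fst x)) (fst (snd x)) (snd (snd x))))
              (list_prod (list_prod all_dirs all_dirs) (list_prod all_colors all_colors)).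

Lemma program_system_tiles : tile_complexity_le program_system 145.
Proof.
  (* The filler and one tile for each pair of directions and pair of colours: 1 + 16 * 9 = 145. *)
  exists all_tiles; split; [vm_compute; lia |].
  intros s j t Ht; destruct (stage_tiles_cases s j t Ht) as [-> | (d & e & a & c & ->)].
  - left; reflexivity.
  - right; apply in_map_iff; exists ((d, e), (a, c)); split; [reflexivity |].
    repeat apply in_prod; [destruct d | destruct e | destruct a | destruct c]; simpl; tauto.
Qed.

Lemma lay_single x : single (ct_tile x) = lay (0, 0) [x].
Proof.
  extensionality q; simpl.
  destruct (pos_eq_dec q (0, 0)) as [-> | n]; [reflexivity |].
  destruct (single (ct_tile x) q) eqn:E; [| reflexivity].
  apply single_some in E; tauto.
Qed.

Lemma stage_mix_join s i a c :
  (s < L)%nat -> (i < B)%nat ->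
  sys_mix program_system (S s) (bin_of i a c) = join_bins s i a c.
Proof.
  intros Hs Hi; cbn [program_system sys_mix stage_mix].
  destruct (Nat.ltb_spec s L); [| lia].
  destruct (Nat.ltb_spec (bin_of i a c) (9 * B)).
  - destruct (bin_of_spec i a c) as (-> & -> & ->); reflexivity.
  - assert (Hb := bin_of_lt i a c B Hi); lia.
Qed.

Lemma stage_tiles_join s j : (s < L)%nat -> sys_tiles program_system (S s) j = [].
Proof.
  intros Hs; cbn [program_system sys_tiles]; unfold stage_tiles.
  destruct (Nat.eqb_spec (S s) 0), (Nat.eqb_spec (S s) (L + 1)), (Nat.eqb_spec (S s) (L + 2)),
    (Nat.eqb_spec j 0); auto; lia.
Qed.

Lemma bin_terminal_S s j :
  bin_terminal 1 program_system (S s) j =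
  terminal 1 str (fun A =>
    (exists t, In t (sys_tiles program_system (S s) j) /\ A = single t) \/
    (exists j', In j' (sys_mix program_system (S s) j) /\
       bin_terminal 1 program_system s j' A)).
Proof. reflexivity. Qed.

(** Factors of a simple linked word without U-turns inherit these properties, so [join_bin] or
    [lonely_bin] applies at every level. The third colour at the seam keeps the end colours of both
    factors distinct. *)
Lemma program_bin s i a c :
  (s <= L)%nat -> (i < B)%nat -> a <> c -> good (word s i) -> word s i <> [] ->
  forall A, bin_terminal 1 program_system s (bin_of i a c) A <-> copies (tiling s i a c) A.
Proof.
  revert i a c; induction s as [| s IH]; intros i a c Hs Hi Hac Hg Hne.
  - destruct Hg as (_ & _ & d & e & Hl).
    eapply lonely_bin; [| apply (chain_tiling 0 i a c d e Hne Hl) | exact Hac].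
    cbn [program_system sys_tiles]; unfold stage_tiles; simpl Nat.eqb; cbv iota.
    destruct (Nat.ltb_spec (bin_of i a c) (9 * B));
      [| assert (Hb := bin_of_lt i a c B Hi); lia].
    unfold base_tiles; destruct (bin_of_spec i a c) as (-> & -> & ->).
    simpl in Hne |- *; destruct (base i) as [l |]; [| congruence].
    split.
    + intros A (t & [<- | []] & ->); exists [CT (fst l) (snd l) a c].
      split; [left; reflexivity |]; exists (0, 0); apply lay_single.
    + intros tw [<- | []]; exists (0, 0), (ct_tile (CT (fst l) (snd l) a c)).
      split; [left; reflexivity |]; rewrite lay_single; reflexivity.
  - rewrite word_S in Hg, Hne; rewrite bin_terminal_S.
    rewrite stage_tiles_join, stage_mix_join by lia; cbn [tiling]; unfold join_bins.
    destruct (live s (fst (prog s i))) as [j |] eqn:E1;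
      destruct (live s (snd (prog s i))) as [j' |] eqn:E2; [| | | congruence];
      try apply live_some in E1; try apply live_some in E2.
    + destruct E1 as (E1 & _ & N1), E2 as (E2 & _ & N2).
      assert (I1 : forall A, bin_terminal 1 program_system s (bin_of j a (third a c)) A <->
                copies (tiling s j a (third a c)) A).
      { apply IH; auto using third_l; [lia | eauto | apply (good_app _ _ Hg)]. }
      assert (I2 : forall A, bin_terminal 1 program_system s (bin_of j' (third a c) c) A <->
                copies (tiling s j' (third a c) c) A).
      { apply IH; auto using third_r; [lia | eauto | apply (good_app _ _ Hg)]. }
      destruct Hg as (Hsi & Hu & d & e & Hl); apply linked_app in Hl.
      destruct Hl as (m & Hl1 & Hl2).
      eapply join_bin with (b := third a c);
        [| apply chain_tiling; eassumption | apply chain_tiling; eassumption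
         | apply tiling_nonempty, N1 | apply tiling_nonempty, N2
         | apply third_l | apply third_r | | | congruence].
      * split.
        -- intros A [(t & [] & _) | (k & [<- | [<- | []]] & Hk)].
           ++ exists (tiling s j a (third a c)); split; [left; reflexivity | apply I1, Hk].
           ++ exists (tiling s j' (third a c) c); split; [right; left; reflexivity | apply I2, Hk].
        -- intros tw Htw; exists (0, 0); right; destruct Htw as [<- | [<- | []]].
           ++ exists (bin_of j a (third a c)); split; [left; reflexivity |].
              apply I1, copies_lay.
           ++ exists (bin_of j' (third a c) c); split; [right; left; reflexivity |].
              apply I2, copies_lay.
      * intros p; rewrite map_app, !map_letter_tiling; apply Hsi.
      * intros x Hx; apply (Hu (ct_letter x)).
        rewrite <- (map_letter_tiling s j a (third a c)), <- (map_letter_tiling s j' (third a c) c).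
        rewrite <- map_app; apply in_map, Hx.
    + destruct E1 as (E1 & _ & N1).
      assert (I1 : forall A, bin_terminal 1 program_system s (bin_of j a c) A <->
                copies (tiling s j a c) A).
      { apply IH; auto; [lia | eauto]. }
      destruct Hg as (Hsi & Hu & d & e & Hl).
      eapply lonely_bin; [| apply (chain_tiling s j a c d e N1 Hl) | exact Hac].
      split.
      * intros A [(t & [] & _) | (k & [<- | []] & Hk)].
        exists (tiling s j a c); split; [left; reflexivity | apply I1, Hk].
      * intros tw [<- | []]; exists (0, 0); right; exists (bin_of j a c).
        split; [left; reflexivity | apply I1, copies_lay].
    + destruct E2 as (E2 & _ & N2).
      assert (I2 : forall A, bin_terminal 1 program_system s (bin_of j' a c) A <->
                copies (tiling s j' a c) A).
      { apply IH; auto; [lia | eauto]. }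
      destruct Hg as (Hsi & Hu & d & e & Hl).
      eapply lonely_bin; [| apply (chain_tiling s j' a c d e N2 Hl) | exact Hac].
      split.
      * intros A [(t & [] & _) | (k & [<- | []] & Hk)].
        exists (tiling s j' a c); split; [left; reflexivity | apply I2, Hk].
      * intros tw [<- | []]; exists (0, 0); right; exists (bin_of j' a c).
        split; [left; reflexivity | apply I2, copies_lay].
Qed.

Definition ring_tiling : list ctile := tiling L 0 C0 C1 ++ [closing].

Context (Hne : word L 0 <> []) (Hlink : linked zo (word L 0) zi)
  (Hgood : good (word L 0 ++ [(zi, zo)]))
  (Hclosed : forall p, endp p (word L 0 ++ [(zi, zo)]) = p).

Lemma map_letter_ring : map ct_letter ring_tiling = word L 0 ++ [(zi, zo)].
Proof. unfold ring_tiling; rewrite map_app, map_letter_tiling; reflexivity. Qed.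

Lemma chain_ring : chain C0 zo ring_tiling C0 zo.
Proof.
  eapply chain_app; [apply chain_tiling; eassumption |].
  simpl; auto.
Qed.

(** The closed case of [join_bin], with outer colours [C0], [C0] and seam colour [C1]. *)
Lemma ring_bin A :
  bin_terminal 1 program_system (L + 1) 0 A <-> copies ring_tiling A.
Proof.
  replace (L + 1)%nat with (S L) by lia; rewrite bin_terminal_S.
  revert A; eapply join_bin with (b := C1);
    [| apply chain_tiling; eassumption | simpl; repeat split; reflexivity
     | apply tiling_nonempty, Hne | discriminate | discriminate | discriminate | | |].
  - cbn [program_system sys_tiles sys_mix]; unfold stage_tiles, stage_mix.
    destruct (Nat.eqb_spec (S L) 0), (Nat.eqb_spec (S L) (L + 1)), (Nat.ltb_spec L L),
      (Nat.eqb_spec L L); try lia; simpl Nat.eqb; cbv iota.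
    assert (I1 : forall A, bin_terminal 1 program_system L (bin_of 0 C0 C1) A <->
              copies (tiling L 0 C0 C1) A).
    { apply program_bin; auto; [discriminate | apply (good_app _ _ Hgood)]. }
    split.
    + intros A [(t & [<- | []] & ->) | (k & [<- | []] & Hk)].
      * exists [closing]; split; [right; left; reflexivity |].
        exists (0, 0); apply lay_single.
      * exists (tiling L 0 C0 C1); split; [left; reflexivity | apply I1, Hk].
    + intros tw [<- | [<- | []]]; exists (0, 0).
      * right; exists (bin_of 0 C0 C1); split; [left; reflexivity | apply I1, copies_lay].
      * left; exists (ct_tile closing); split; [left; reflexivity |].
        symmetry; apply lay_single.
  - intros p; change (NoDup (cells p (map ct_letter ring_tiling))); rewrite map_letter_ring.
    apply Hgood.
  - intros x Hx; apply (proj1 (proj2 Hgood) (ct_letter x)).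
    rewrite <- map_letter_ring; apply in_map, Hx.
  - intros _; split; [reflexivity |]; intros p.
    change (endp p (map ct_letter ring_tiling) = p); rewrite map_letter_ring; apply Hclosed.
Qed.

Lemma program_output (I : pos -> bool) p0 :
  encloses (lay p0 ring_tiling) I ->
  forall A, output 1 program_system A <->
    exists v, A = translate (fill (lay p0 ring_tiling) I) v.
Proof.
  intros HI A.
  assert (Hlast : bin_terminal 1 program_system (L + 2) 0 A <->
            exists v, A = translate (fill (lay p0 ring_tiling) I) v).
  { replace (L + 2)%nat with (S (L + 1)) by lia; rewrite bin_terminal_S.
    cbn [program_system sys_tiles sys_mix]; unfold stage_tiles, stage_mix.
    destruct (Nat.eqb_spec (S (L + 1)) 0), (Nat.eqb_spec (S (L + 1)) (L + 1)),
      (Nat.eqb_spec (S (L + 1)) (L + 2)), (Nat.ltb_spec (L + 1) L),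
      (Nat.eqb_spec (L + 1) L), (Nat.eqb_spec (L + 1) (L + 1)); try lia;
      simpl Nat.eqb; cbv iota.
    apply fill_bin; [exact HI | | |].
    - intros A' [(t & [<- | []] & ->) | (k & [<- | []] & Hk)]; [auto | right].
      apply ring_bin in Hk; destruct Hk as [q ->]; exists (psub q p0).
      rewrite translate_lay; f_equal; pos_solve.
    - left; exists filler; split; [left; reflexivity | reflexivity].
    - exists (0, 0); right; exists 0%nat; split; [left; reflexivity |].
      apply ring_bin; rewrite translate_0; apply copies_lay. }
  unfold output; cbn [program_system sys_out sys_stages].
  replace (L + 3 - 1)%nat with (L + 2)%nat by lia; split.
  - intros (j & [<- | []] & Hj); apply Hlast, Hj.
  - intros Hv; exists 0%nat; split; [left; reflexivity | apply Hlast, Hv].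
Qed.

End Program.

(** * A program for a word with few runs *)

Definition expand (runs : list (letter * nat)) : list letter :=
  concat (map (fun x => repeat (fst x) (snd x)) runs).

Lemma skipn_add {X} (m k : nat) (l : list X) : skipn (m + k) l = skipn k (skipn m l).
Proof.
  revert l; induction m as [| m IH]; intros l; simpl; [reflexivity |].
  destruct l; [rewrite skipn_nil; reflexivity | apply IH].
Qed.

Lemma firstn_add {X} (m k : nat) (l : list X) :
  firstn (m + k) l = firstn m l ++ firstn k (skipn m l).
Proof.
  revert l; induction m as [| m IH]; intros l; simpl; [reflexivity |].
  destruct l; simpl; [rewrite firstn_nil; reflexivity | rewrite IH; reflexivity].
Qed.

Section Runs.

Context (runs : list (letter * nat)) (K : nat)
  (Hcount : forall l e, In (l, e) runs -> (e < 2 ^ K)%nat)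
  (Hlen : (length runs <= 2 ^ K)%nat) (Hne : runs <> []).

Definition width : nat := (2 * length runs)%nat.

Definition run_count (i : nat) : nat :=
  match nth_error runs i with Some (_, e) => e | None => 0%nat end.

(** Before any digit is read the exponent is 0, so the two slots of a run start with the powers 0
    and 1 of its letter. *)
Definition run_base (i : nat) : option letter :=
  if Nat.odd i then option_map fst (nth_error runs (i / 2)) else None.

(** References past the last slot are read as the empty word; this keeps the number of bins bounded
    while slots are paired up. *)
Definition guard (j : nat) : option nat := if Nat.ltb j width then Some j else None.

(** Levels up to [K] read the binary digits of each count [e], slots [2 i] and
    [2 i + 1] holding the powers [e / 2 ^ (K - s)] and [e / 2 ^ (K - s) + 1];
    the later levels concatenate neighbouring slots. *)
Definition run_prog (s i : nat) : option nat * option nat :=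
  if Nat.ltb s K then
    (guard i, guard (2 * (i / 2) + Nat.b2n (Nat.testbit (run_count (i / 2)) (K - 1 - s))))
  else if Nat.eqb s K then (guard (2 * i), None)
  else (guard (2 * i), guard (2 * i + 1)).

Lemma run_prog_digit s i : (s < K)%nat ->
  run_prog s i =
  (guard i, guard (2 * (i / 2) + Nat.b2n (Nat.testbit (run_count (i / 2)) (K - 1 - s)))).
Proof. intros Hs; unfold run_prog; destruct (Nat.ltb_spec s K); [reflexivity | lia]. Qed.

Lemma run_prog_select i : run_prog K i = (guard (2 * i), None).
Proof. unfold run_prog; rewrite Nat.ltb_irrefl, Nat.eqb_refl; reflexivity. Qed.

Lemma run_prog_pair t i : run_prog (K + 1 + t) i = (guard (2 * i), guard (2 * i + 1)).
Proof.
  unfold run_prog; destruct (Nat.ltb_spec (K + 1 + t) K); [lia |].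
  destruct (Nat.eqb_spec (K + 1 + t) K); [lia | reflexivity].
Qed.

Lemma guard_lt j k : guard j = Some k -> (k < width)%nat.
Proof.
  unfold guard; destruct (Nat.ltb_spec j width); [intros [= <-]; auto | discriminate].
Qed.

Lemma run_prog_lt s i j :
  fst (run_prog s i) = Some j \/ snd (run_prog s i) = Some j -> (j < width)%nat.
Proof.
  unfold run_prog; destruct (Nat.ltb s K), (Nat.eqb s K); simpl;
    intros [E | E]; try discriminate; eapply guard_lt; eauto.
Qed.

Lemma width_pos : (0 < width)%nat.
Proof.
  apply Nat.mul_pos_pos; [apply Nat.lt_0_2 | apply Nat.neq_0_lt_0].
  intros E; apply length_zero_iff_nil in E; auto.
Qed.

Notation W := (word run_base run_prog).

Lemma get_guard (w : nat -> list letter) j : (j < width)%nat -> get w (guard j) = w j.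
Proof. intros Hj; unfold guard; destruct (Nat.ltb_spec j width); [reflexivity | lia]. Qed.

Lemma half_even i : ((2 * i) / 2 = i)%nat.
Proof. rewrite Nat.mul_comm; apply Nat.div_mul; lia. Qed.

Lemma half_odd i : ((2 * i + 1) / 2 = i)%nat.
Proof. symmetry; apply Nat.div_unique with 1%nat; lia. Qed.

(** Reading a digit [b] turns the exponent [q] into [2 * q + b]. The new pair comes from the old
    one, as [2 * q + b] is [q + (q + b)] and its successor is [(q + 1) + (q + b)], where [q + b] is
    again one of the two old exponents. *)
Lemma word_powers s i l e :
  (s <= K)%nat -> nth_error runs i = Some (l, e) ->
  W s (2 * i) = repeat l (e / 2 ^ (K - s)) /\
  W s (2 * i + 1) = repeat l (e / 2 ^ (K - s) + 1).
Proof.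
  intros Hs Hi.
  assert (Hw : (2 * i + 1 < width)%nat).
  { assert (Hl : nth_error runs i <> None) by congruence.
    apply nth_error_Some in Hl; unfold width; lia. }
  revert Hs; induction s as [| s IH]; intros Hs.
  - assert (He : (e < 2 ^ K)%nat) by (apply (Hcount l), (nth_error_In _ _ Hi)).
    rewrite Nat.sub_0_r, Nat.div_small by exact He.
    cbn [word]; unfold run_base; rewrite half_even, half_odd, Hi.
    replace (Nat.odd (2 * i)) with false by (rewrite Nat.odd_mul; reflexivity).
    replace (Nat.odd (2 * i + 1)) with true
      by (rewrite Nat.add_1_r, Nat.odd_succ, Nat.even_mul; reflexivity).
    auto.
  - destruct IH as [IH1 IH2]; [lia |].
    cbn [word]; rewrite !run_prog_digit, half_even, half_odd by lia.
    assert (Hc : run_count i = e) by (unfold run_count; rewrite Hi; reflexivity).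
    rewrite Hc.
    set (q := (e / 2 ^ (K - S s))%nat).
    assert (Hq : (e / 2 ^ (K - s) = q / 2)%nat).
    { unfold q; rewrite Nat.Div0.div_div; f_equal.
      replace (K - s)%nat with (S (K - S s)) by lia; rewrite Nat.pow_succ_r'; lia. }
    assert (Hb : Nat.testbit e (K - 1 - s) = Nat.odd q).
    { unfold q; replace (K - 1 - s)%nat with (K - S s)%nat by lia.
      rewrite Nat.testbit_odd, Nat.shiftr_div_pow2; reflexivity. }
    rewrite Hb; rewrite Hq in IH1, IH2.
    assert (Hd := Nat.div2_odd q); rewrite Nat.div2_div in Hd.
    cbn [fst snd].
    rewrite !get_guard by (destruct (Nat.odd q); simpl; lia).
    assert (E : W s (2 * i + Nat.b2n (Nat.odd q)) = repeat l (q / 2 + Nat.b2n (Nat.odd q))).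
    { destruct (Nat.odd q); simpl Nat.b2n; [exact IH2 |].
      rewrite !Nat.add_0_r; exact IH1. }
    rewrite E, IH1, IH2, <- !repeat_app; split; f_equal; lia.
Qed.

Definition block (t i : nat) : list letter :=
  expand (firstn (2 ^ t) (skipn (i * 2 ^ t) runs)).

Lemma block_overflow t i : (width <= i)%nat -> block t i = [].
Proof.
  intros Hi; unfold block; rewrite skipn_all2, firstn_nil; [reflexivity |].
  unfold width in Hi; assert (Hp : (2 ^ t <> 0)%nat) by (apply Nat.pow_nonzero; lia).
  nia.
Qed.

(** Level [K + 1] moves the finished power of run [i] from slot [2 * i] to slot [i]. From there each
    level doubles the number of consecutive runs gathered in a slot. *)
Lemma word_blocks t i : W (K + 1 + t) i = block t i.
Proof.
  revert i; induction t as [| t IH]; intros i.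
  - rewrite Nat.add_0_r, Nat.add_1_r; cbn [word].
    rewrite run_prog_select; cbn [fst snd get].
    rewrite app_nil_r; unfold block; rewrite Nat.pow_0_r, Nat.mul_1_r.
    destruct (nth_error runs i) as [[l e] |] eqn:Ei.
    + assert (Hl : nth_error runs i <> None) by congruence.
      apply nth_error_Some in Hl.
      rewrite get_guard by (unfold width; lia).
      destruct (word_powers K i l e (le_n _) Ei) as [-> _].
      rewrite Nat.sub_diag, Nat.pow_0_r, Nat.div_1_r.
      destruct (nth_error_split _ _ Ei) as (u & v & -> & <-).
      rewrite skipn_app, skipn_all, Nat.sub_diag; simpl; unfold expand; simpl.
      rewrite app_nil_r; reflexivity.
    + apply nth_error_None in Ei.
      unfold guard; destruct (Nat.ltb_spec (2 * i) width); [unfold width in *; lia |].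
      rewrite skipn_all2, firstn_nil by exact Ei; reflexivity.
  - replace (K + 1 + S t)%nat with (S (K + 1 + t)) by lia; cbn [word].
    rewrite run_prog_pair; cbn [fst snd].
    assert (G : forall j, get (W (K + 1 + t)) (guard j) = block t j).
    { intros j; unfold guard; destruct (Nat.ltb_spec j width) as [Hj | Hj]; simpl.
      - apply IH.
      - symmetry; apply block_overflow, Hj. }
    rewrite !G; unfold block, expand; rewrite <- concat_app, <- map_app.
    f_equal; f_equal.
    rewrite Nat.pow_succ_r'.
    replace (2 * 2 ^ t)%nat with (2 ^ t + 2 ^ t)%nat by lia.
    replace (i * (2 ^ t + 2 ^ t))%nat with (2 * i * 2 ^ t)%nat by lia.
    replace ((2 * i + 1) * 2 ^ t)%nat with (2 * i * 2 ^ t + 2 ^ t)%nat by lia.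
    rewrite firstn_add, skipn_add; reflexivity.
Qed.

(** [K] levels for the digits, one for the selection, and [K] doublings, after which a slot spans
    [2 ^ K] runs and hence all of them. *)
Lemma word_runs : W (2 * K + 1) 0 = expand runs.
Proof.
  replace (2 * K + 1)%nat with (K + 1 + K)%nat by lia.
  rewrite word_blocks; unfold block; simpl skipn.
  rewrite firstn_all2 by exact Hlen; reflexivity.
Qed.

End Runs.

Definition straight (l : letter) : bool :=
  if dir_eq_dec (fst l) (snd l) then true else false.

Definition turns (w : list letter) : nat :=
  length (filter (fun l => negb (straight l)) w).

Lemma expand_length_count runs l e :
  In (l, e) runs -> (e <= length (expand runs))%nat.
Proof.
  unfold expand; induction runs as [| x runs IH]; simpl; [intros [] |].
  rewrite length_app; intros [-> | Hi].
  - simpl; rewrite repeat_length; lia.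
  - specialize (IH Hi); lia.
Qed.

(** Consecutive straight letters of a linked word are equal, so runs only end
    at turns. *)
Lemma linked_runs d w e :
  linked d w e ->
  exists runs, expand runs = w /\ (length runs <= length w)%nat /\
    (length runs <= 2 * turns w + 1)%nat.
Proof.
  (* A turn pays for its own run and for a straight run behind it; only a straight run at the front
     needs an extra unit. The first run is kept visible because a new letter can merge with that one
     alone. *)
  assert (main : forall w d e, linked d w e ->
    exists runs, expand runs = w /\ (length runs <= length w)%nat /\
    match w with
    | [] => runs = []
    | l :: _ => (exists n runs', runs = (l, n) :: runs') /\
        (length runs <= 2 * turns w + if straight l then 1 else 0)%nat
    end).
  { clear; induction w as [| l w IH]; intros d e Hl.
    - exists []; auto.
    - destruct Hl as [Hl1 Hl2]; destruct (IH _ _ Hl2) as (runs & Hr & Hn & Hc).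
      destruct w as [| l' w].
      + exists [(l, 1%nat)]; subst runs; unfold expand, turns; simpl; repeat split; eauto.
        destruct (straight l); simpl; lia.
      + destruct Hc as [(n & runs' & ->) Hc].
        destruct (straight l && straight l') eqn:Es.
        * apply andb_true_iff in Es; destruct Es as [Es Es'].
          assert (l = l').
          { destruct Hl2 as [Hl2 _]; unfold straight in *.
            destruct (dir_eq_dec (fst l) (snd l)); [| discriminate].
            destruct (dir_eq_dec (fst l') (snd l')); [| discriminate].
            destruct l, l'; simpl in *; congruence. }
          subst l'; exists ((l, S n) :: runs'); rewrite <- Hr.
          split; [reflexivity |]; split; [rewrite Hr; simpl in *; lia |].
          split; [eauto |].
          rewrite Es in *; unfold turns in *; rewrite Hr; simpl in *; rewrite Es in *.
          simpl in *; lia.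
        * exists ((l, 1%nat) :: (l', n) :: runs').
          split; [unfold expand in *; simpl in *; rewrite Hr; reflexivity |].
          split; [simpl in *; lia |]; split; [eauto |].
          unfold turns in *; simpl in *.
          destruct (straight l), (straight l'); simpl in *; try discriminate; lia. }
  intros Hl; destruct (main w d e Hl) as (runs & Hr & Hn & Hc); exists runs.
  split; [exact Hr |]; split; [exact Hn |].
  destruct w as [| l w]; [subst; simpl; lia |].
  destruct Hc as [_ Hc]; destruct (straight l); lia.
Qed.

(** * The boundary ring *)

(** A view [v] tells which cells around a cell, placed at [(0, 0)], belong to
    the scaled polyomino. *)
Definition view := Z -> Z -> bool.

Definition eqd (d e : dir) : bool := if dir_eq_dec d e then true else false.

Definition at_dir (v : view) (d : dir) : bool := v (fst (vec d)) (snd (vec d)).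

Definition shift (v : view) (d : dir) : view :=
  fun x y => v (fst (vec d) + x) (snd (vec d) + y).

Definition ringv (v : view) : bool :=
  v 0 0 && negb (v 1 0 && v 1 1 && v 0 1 && v (-1) 1 && v (-1) 0 && v (-1) (-1)
                 && v 0 (-1) && v 1 (-1)).

(** The outside is kept on the right. Two missing sides form a convex corner, where the walk turns
    left. If all four sides are present, a missing diagonal neighbour marks a reflex corner, where
    it turns right. [inv] makes the matching choice for the move by which the cell is entered. *)
Definition outv (v : view) : dir :=
  if negb (v 0 (-1)) then (if v 1 0 then DE else DN)
  else if negb (v 1 0) then (if v 0 1 then DN else DW)
  else if negb (v 0 1) then (if v (-1) 0 then DW else DS)
  else if negb (v (-1) 0) then DS
  else if negb (v (-1) (-1)) then DS
  else if negb (v 1 (-1)) then DE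
  else if negb (v 1 1) then DN
  else DW.

Definition inv (v : view) : dir :=
  if negb (v 0 (-1)) then (if v (-1) 0 then DE else DS)
  else if negb (v 1 0) then DN
  else if negb (v 0 1) then DW
  else if negb (v (-1) 0) then DS
  else if negb (v (-1) (-1)) then DE
  else if negb (v 1 (-1)) then DN
  else if negb (v 1 1) then DW
  else DS.

Definition has_side (v : view) : bool :=
  existsb (fun d => negb (at_dir v d)) all_dirs.

(** Successor and predecessor lie on the ring and agree with the walk, the other two neighbours do
    not lie on it, and the glues of [free_side] match the geometry. The last clause is there for
    reflex corners: such a cell has no side facing the outside, but its successor has. *)
Definition check_ring (v : view) : bool :=
  let d := outv v in let e := inv v in
  ringv (shift v d) && eqd (inv (shift v d)) d &&
  ringv (shift v (opp e)) && eqd (outv (shift v (opp e))) e &&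
  negb (eqd d (opp e)) &&
  forallb (fun f => eqd f d || eqd f (opp e) ||
    (negb (ringv (shift v f)) &&
     Nat.eqb (free_side e d f) (if at_dir v f then inner_glue else 0%nat))) all_dirs &&
  (has_side v || has_side (shift v d)).

(** Where the boundary runs through a 2 x 2 window, the cells along its inner side are linked by
    steps of the walk. A weight that is constant along the walk then enters and leaves the window in
    equal amounts. A single cell, or two diagonal ones, need no link, since one cell carries both
    crossings of its corner. *)
Definition check_corner (v : view) : bool :=
  let a := v 0 0 in let b := v 1 0 in let c := v 0 1 in let d := v 1 1 in
  let vb := shift v DE in let vc := shift v DN in let vd := shift vb DN in
  let arrow w x := ringv w && eqd (outv w) x in
  match a, b, c, d with
  | true, true, false, false => arrow vb DW
  | false, false, true, true => arrow vc DE
  | true, false, true, false => arrow v DN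
  | false, true, false, true => arrow vd DS
  | true, true, true, false => arrow vb DW && arrow v DN
  | true, true, false, true => arrow vd DS && arrow vb DW
  | false, true, true, true => arrow vc DE && arrow vd DS
  | true, false, true, true => arrow v DN && arrow vc DE
  | _, _, _, _ => true
  end.

Definition vertexb (a b c d : bool) : bool :=
  xorb (xorb a b) (xorb c d) || (eqb a d && eqb b c && negb (eqb a b)).

(** [(ox, oy)] is the offset of the cell in its [4 x 4] block. *)
Definition check_turn (v : view) (ox oy : Z) : bool :=
  let sx := if Z.eqb ox 3 then 1 else 0 in
  let sy := if Z.eqb oy 3 then 1 else 0 in
  let pix i j := v (4 * (sx + i) - ox) (4 * (sy + j) - oy) in
  (Z.eqb ox 0 || Z.eqb ox 3) && (Z.eqb oy 0 || Z.eqb oy 3) &&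
  vertexb (pix (-1) (-1)) (pix 0 (-1)) (pix (-1) 0) (pix 0 0).

Definition check (v : view) (ox oy : Z) : bool :=
  implb (ringv v) (check_ring v) && check_corner v &&
  implb (ringv v && negb (eqd (outv v) (inv v))) (check_turn v ox oy).

(** The 3 x 3 pixels row by row from the bottom left, extended to all coordinates by their signs. *)
Definition table (b1 b2 b3 b4 b5 b6 b7 b8 b9 : bool) : view := fun x y =>
  if y <? 0 then (if x <? 0 then b1 else if x =? 0 then b2 else b3)
  else if y =? 0 then (if x <? 0 then b4 else if x =? 0 then b5 else b6)
  else (if x <? 0 then b7 else if x =? 0 then b8 else b9).

Definition block_view (m : view) (ox oy : Z) : view :=
  fun x y => m ((ox + x) / 4) ((oy + y) / 4).

Definition all_bool (f : bool -> bool) : bool := f true && f false.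

Lemma all_bool_spec f : all_bool f = true -> forall b, f b = true.
Proof. unfold all_bool; intros H; apply andb_true_iff in H; intros []; tauto. Qed.

(** The local claims about a cell only involve the [3 x 3] pixels around its
    block, so they are decided by computation. *)
Lemma check_tables ox oy b1 b2 b3 b4 b5 b6 b7 b8 b9 :
  In ox [0; 1; 2; 3] -> In oy [0; 1; 2; 3] ->
  check (block_view (table b1 b2 b3 b4 b5 b6 b7 b8 b9) ox oy) ox oy = true.
Proof.
  assert (H : forallb (fun ox => forallb (fun oy =>
    all_bool (fun b1 => all_bool (fun b2 => all_bool (fun b3 =>
    all_bool (fun b4 => all_bool (fun b5 => all_bool (fun b6 =>
    all_bool (fun b7 => all_bool (fun b8 => all_bool (fun b9 =>
      check (block_view (table b1 b2 b3 b4 b5 b6 b7 b8 b9) ox oy) ox oy))))))))))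
    [0; 1; 2; 3]) [0; 1; 2; 3] = true) by (vm_compute; reflexivity).
  intros Hx Hy.
  rewrite forallb_forall in H; specialize (H ox Hx); cbv beta in H.
  rewrite forallb_forall in H; specialize (H oy Hy); cbv beta in H.
  eapply all_bool_spec in H; eapply all_bool_spec in H; eapply all_bool_spec in H;
  eapply all_bool_spec in H; eapply all_bool_spec in H; eapply all_bool_spec in H;
  eapply all_bool_spec in H; eapply all_bool_spec in H; eapply all_bool_spec in H.
  exact H.
Qed.

Definition agree (r : Z) (v w : view) : Prop :=
  forall x y, - r <= x <= r -> - r <= y <= r -> v x y = w x y.

Lemma agree_shift r v w d : agree (r + 1) v w -> agree r (shift v d) (shift w d).
Proof. intros H x y Hx Hy; unfold shift; apply H; destruct d; cbn [vec fst snd]; lia. Qed.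

Lemma ringv_agree v w : agree 1 v w -> ringv v = ringv w.
Proof. intros H; unfold ringv; rewrite !H by lia; reflexivity. Qed.

Lemma outv_agree v w : agree 1 v w -> outv v = outv w.
Proof. intros H; unfold outv; rewrite !H by lia; reflexivity. Qed.

Lemma inv_agree v w : agree 1 v w -> inv v = inv w.
Proof. intros H; unfold inv; rewrite !H by lia; reflexivity. Qed.

Lemma at_dir_agree v w d : agree 1 v w -> at_dir v d = at_dir w d.
Proof. intros H; unfold at_dir; apply H; destruct d; cbn [vec fst snd]; lia. Qed.

Lemma has_side_agree v w : agree 1 v w -> has_side v = has_side w.
Proof.
  intros H; unfold has_side; simpl; rewrite !(at_dir_agree v w _ H); reflexivity.
Qed.

Lemma agree_le r s v w : s <= r -> agree r v w -> agree s v w.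
Proof. intros Hs H x y Hx Hy; apply H; lia. Qed.

(** The furthest look of the ring and corner tests is two shifts followed by a window of radius 1,
    hence radius 3. The turn test reads one cell of each pixel at a block corner. All this stays
    within the block and its eight neighbours, at offsets -4 to 7. *)
Lemma check_agree v w ox oy :
  0 <= ox <= 3 -> 0 <= oy <= 3 ->
  (forall x y, -4 <= ox + x <= 7 -> -4 <= oy + y <= 7 -> v x y = w x y) ->
  check v ox oy = check w ox oy.
Proof.
  intros Hox Hoy H.
  assert (H3 : agree 3 v w) by (intros x y Hx Hy; apply H; lia).
  assert (H1 : agree 1 v w) by (eapply agree_le; [| exact H3]; lia).
  assert (S2 : forall d, agree 2 (shift v d) (shift w d)) by (intros; apply agree_shift, H3).
  assert (S1 : forall d, agree 1 (shift v d) (shift w d))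
    by (intros; eapply agree_le; [| apply S2]; lia).
  assert (T1 : forall d e, agree 1 (shift (shift v d) e) (shift (shift w d) e))
    by (intros; apply agree_shift, S2).
  assert (Ering : check_ring v = check_ring w).
  { unfold check_ring; cbn [forallb all_dirs].
    rewrite (outv_agree v w H1), (inv_agree v w H1), (has_side_agree v w H1).
    rewrite !(ringv_agree _ _ (S1 _)), (inv_agree _ _ (S1 _)), (outv_agree _ _ (S1 _)),
      (has_side_agree _ _ (S1 _)), !(at_dir_agree v w _ H1); reflexivity. }
  assert (Ecorner : check_corner v = check_corner w).
  { unfold check_corner; cbv zeta; rewrite !H3 by lia.
    rewrite (ringv_agree v w H1), (outv_agree v w H1).
    rewrite !(ringv_agree _ _ (S1 _)), !(outv_agree _ _ (S1 _)).
    rewrite !(ringv_agree _ _ (T1 _ _)), !(outv_agree _ _ (T1 _ _)); reflexivity. }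
  assert (Eturn : check_turn v ox oy = check_turn w ox oy).
  { unfold check_turn; cbv zeta.
    destruct (Z.eqb_spec ox 0), (Z.eqb_spec ox 3), (Z.eqb_spec oy 0), (Z.eqb_spec oy 3);
      cbn [andb orb]; try reflexivity; try lia; rewrite !H by lia; reflexivity. }
  unfold check; rewrite Ering, Ecorner, Eturn, (ringv_agree v w H1), (outv_agree v w H1),
    (inv_agree v w H1); reflexivity.
Qed.

Lemma check_blocks m ox oy :
  0 <= ox <= 3 -> 0 <= oy <= 3 -> check (block_view m ox oy) ox oy = true.
Proof.
  intros Hx Hy.
  rewrite (check_agree _ (block_view (table (m (-1) (-1)) (m 0 (-1)) (m 1 (-1))
    (m (-1) 0) (m 0 0) (m 1 0) (m (-1) 1) (m 0 1) (m 1 1)) ox oy)) by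
    (auto; intros x y Hx' Hy'; unfold block_view;
     assert (Hc : forall z, -4 <= z <= 7 -> z / 4 = -1 \/ z / 4 = 0 \/ z / 4 = 1) by
       (intros z Hz; assert (-1 <= z / 4) by (apply Z.div_le_lower_bound; lia);
        assert (z / 4 < 2) by (apply Z.div_lt_upper_bound; lia); lia);
     destruct (Hc _ Hx') as [-> | [-> | ->]], (Hc _ Hy') as [-> | [-> | ->]]; reflexivity).
  apply check_tables; simpl; lia.
Qed.

(** * Local facts transferred to the polyomino *)

Section Ring.

Context (P : poly).

Lemma memb_In p : memb p P = true <-> In p P.
Proof.
  unfold memb; rewrite existsb_exists; split.
  - intros (q & Hq & E); apply andb_true_iff in E; destruct E as [E1 E2].
    apply Z.eqb_eq in E1, E2; destruct p, q; simpl in *; subst; exact Hq.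
  - intros H; exists p; rewrite !Z.eqb_refl; auto.
Qed.

Definition pixel (c : pos) : pos := (fst c / 4, snd c / 4).
Definition cellb (c : pos) : bool := memb (pixel c) P.
Definition view_at (c : pos) : view := fun x y => cellb (fst c + x, snd c + y).
Definition ringb (c : pos) : bool := ringv (view_at c).
Definition insideb (c : pos) : bool := cellb c && negb (ringb c).
Definition out_dir (c : pos) : dir := outv (view_at c).
Definition in_dir (c : pos) : dir := inv (view_at c).
Definition next (c : pos) : pos := step c (out_dir c).
Definition prev (c : pos) : pos := step c (opp (in_dir c)).

Lemma view_at_block c :
  view_at c = block_view (fun i j => memb (fst c / 4 + i, snd c / 4 + j) P)
                (fst c mod 4) (snd c mod 4).
Proof.
  extensionality x; extensionality y.
  unfold view_at, block_view, cellb, pixel; f_equal; simpl.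
  assert (E : forall a b, (a + b) / 4 = a / 4 + (a mod 4 + b) / 4).
  { intros a b; rewrite (Z.div_mod a 4) at 1 by lia.
    replace (4 * (a / 4) + a mod 4 + b) with (a mod 4 + b + a / 4 * 4) by lia.
    rewrite Z.div_add by lia; lia. }
  f_equal; apply E.
Qed.

Lemma view_at_0 c : view_at c 0 0 = cellb c.
Proof. unfold view_at; rewrite !Z.add_0_r; destruct c; reflexivity. Qed.

Lemma view_at_dir c d : at_dir (view_at c) d = cellb (step c d).
Proof. reflexivity. Qed.

Lemma view_at_step c d : view_at (step c d) = shift (view_at c) d.
Proof.
  extensionality x; extensionality y; unfold view_at, shift; f_equal.
  unfold step, padd; simpl; f_equal; lia.
Qed.

Lemma check_at c : check (view_at c) (fst c mod 4) (snd c mod 4) = true.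
Proof.
  rewrite view_at_block; apply check_blocks;
    assert (H1 := Z.mod_pos_bound (fst c) 4); assert (H2 := Z.mod_pos_bound (snd c) 4); lia.
Qed.

Lemma eqd_true d e : eqd d e = true <-> d = e.
Proof. unfold eqd; destruct (dir_eq_dec d e); split; congruence. Qed.

Lemma ring_cell c : ringb c = true -> cellb c = true.
Proof.
  unfold ringb, ringv; intros H; apply andb_true_iff in H; destruct H as [H _].
  rewrite view_at_0 in H; exact H.
Qed.

Lemma ring_of_side c d : cellb c = true -> cellb (step c d) = false -> ringb c = true.
Proof.
  intros Hc Hd; unfold ringb, ringv; rewrite view_at_0, Hc.
  rewrite <- view_at_dir in Hd; unfold at_dir in Hd.
  destruct d; simpl in Hd; rewrite Hd; rewrite ?andb_false_r; reflexivity.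
Qed.

Record ring_facts (c : pos) : Prop := {
  rf_next : ringb (next c) = true;
  rf_next_in : in_dir (next c) = out_dir c;
  rf_prev : ringb (prev c) = true;
  rf_prev_out : out_dir (prev c) = in_dir c;
  rf_no_uturn : out_dir c <> opp (in_dir c);
  rf_free : forall f, f <> out_dir c -> f <> opp (in_dir c) ->
    ringb (step c f) = false /\
    free_side (in_dir c) (out_dir c) f = if cellb (step c f) then inner_glue else 0%nat;
  rf_side : (exists d, cellb (step c d) = false) \/
            (exists d, cellb (step (next c) d) = false) }.

Lemma ring_local c : ringb c = true -> ring_facts c.
Proof.
  intros Hr; assert (H := check_at c); unfold check in H.
  apply andb_true_iff in H; destruct H as [H _]; apply andb_true_iff in H; destruct H as [H _].
  fold (ringb c) in H; rewrite Hr in H; cbn [implb] in H; unfold check_ring in H.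
  cbv zeta in H; fold (out_dir c) (in_dir c) in H.
  rewrite <- !view_at_step in H; fold (next c) (prev c) in H.
  repeat match goal with
         | H : _ && _ = true |- _ => apply andb_true_iff in H; destruct H
         end.
  repeat match goal with H : eqd _ _ = true |- _ => apply eqd_true in H end.
  match goal with H : negb (eqd _ _) = true |- _ =>
    apply negb_true_iff in H; rename H into Hu end.
  split; auto.
  - intros E; apply eqd_true in E; congruence.
  - intros f Hf1 Hf2.
    match goal with H : forallb _ _ = true |- _ => rewrite forallb_forall in H; specialize (H f);
      rename H into HF end.
    assert (Hf : In f all_dirs) by (destruct f; simpl; tauto).
    apply HF in Hf; clear HF; rewrite <- view_at_step in Hf.
    destruct (eqd f (out_dir c)) eqn:E1; [apply eqd_true in E1; congruence |].
    destruct (eqd f (opp (in_dir c))) eqn:E2; [apply eqd_true in E2; congruence |].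
    cbn [orb] in Hf; apply andb_true_iff in Hf; destruct Hf as [G1 G2].
    apply negb_true_iff in G1; apply Nat.eqb_eq in G2; rewrite view_at_dir in G2; auto.
  - match goal with H : _ || _ = true |- _ => apply orb_true_iff in H; destruct H as [H | H];
      apply existsb_exists in H; destruct H as (d & _ & H); apply negb_true_iff in H end;
      [left | right]; exists d; auto.
Qed.

Lemma prev_next c : ringb c = true -> prev (next c) = c.
Proof.
  intros H; unfold prev; rewrite (rf_next_in _ (ring_local c H)); apply step_opp.
Qed.

Lemma next_prev c : ringb c = true -> next (prev c) = c.
Proof.
  intros H; unfold next; rewrite (rf_prev_out _ (ring_local c H)); apply opp_step.
Qed.

Lemma inside_step c d :
  insideb c = true -> insideb (step c d) = true \/ ringb (step c d) = true.
Proof.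
  unfold insideb; intros H; apply andb_true_iff in H; destruct H as [H1 H2].
  apply negb_true_iff in H2.
  destruct (cellb (step c d)) eqn:E.
  - destruct (ringb (step c d)); auto.
  - rewrite (ring_of_side c d H1 E) in H2; discriminate.
Qed.

Definition corner_cells (v : pos) : list pos :=
  [(4 * fst v - 1, 4 * snd v - 1); (4 * fst v, 4 * snd v - 1);
   (4 * fst v - 1, 4 * snd v); (4 * fst v, 4 * snd v)].

(** A turning cell sits at a corner of its block, and the lattice point there is a vertex of [P].
    Since only four cells surround a vertex, this is what bounds the number of turns by [4 * k]. *)
Lemma turn_at_vertex c :
  ringb c = true -> out_dir c <> in_dir c ->
  exists v, is_vertex P v /\ In c (corner_cells v).
Proof.
  intros Hr Ht; assert (H := check_at c); unfold check in H.
  apply andb_true_iff in H; destruct H as [_ H].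
  fold (ringb c) (out_dir c) (in_dir c) in H; rewrite Hr in H.
  destruct (eqd (out_dir c) (in_dir c)) eqn:E; [apply eqd_true in E; congruence |].
  cbn [implb andb negb] in H; unfold check_turn in H; cbv zeta in H.
  apply andb_true_iff in H; destruct H as [H Hv].
  apply andb_true_iff in H; destruct H as [Hx Hy].
  set (sx := if fst c mod 4 =? 3 then 1 else 0) in *.
  set (sy := if snd c mod 4 =? 3 then 1 else 0) in *.
  exists (fst c / 4 + sx, snd c / 4 + sy); split.
  - unfold view_at, cellb, pixel in Hv; cbn [fst snd] in Hv.
    (* The relative coordinate [4 * k - a mod 4] is the first cell of the block [k] places further
       on. *)
    assert (Ed : forall a k, (a + (4 * k - a mod 4)) / 4 = a / 4 + k).
    { intros a k; rewrite (Z.div_mod a 4) at 1 by lia.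
      replace (4 * (a / 4) + a mod 4 + (4 * k - a mod 4)) with ((a / 4 + k) * 4) by lia.
      apply Z.div_mul; lia. }
    rewrite !Ed in Hv; unfold is_vertex; cbn [fst snd].
    rewrite !Z.add_assoc, !Z.add_0_r in Hv.
    unfold Z.sub; simpl Z.opp.
    revert Hv; unfold vertexb.
    destruct (memb (fst c / 4 + sx + -1, snd c / 4 + sy + -1) P),
      (memb (fst c / 4 + sx, snd c / 4 + sy + -1) P),
      (memb (fst c / 4 + sx + -1, snd c / 4 + sy) P),
      (memb (fst c / 4 + sx, snd c / 4 + sy) P); simpl; intros; try discriminate;
      try (left; reflexivity); right; repeat split; discriminate.
  - unfold corner_cells; cbn [fst snd].
    assert (D1 := Z.div_mod (fst c) 4 ltac:(lia)).
    assert (D2 := Z.div_mod (snd c) 4 ltac:(lia)).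
    apply orb_true_iff in Hx, Hy; rewrite !Z.eqb_eq in Hx, Hy.
    unfold sx, sy; destruct c as [x y]; cbn [fst snd In] in *.
    destruct Hx as [Hx | Hx], Hy as [Hy | Hy]; rewrite Hx, Hy in *; cbn [Z.eqb Pos.eqb];
      [do 3 right; left | right; left | do 2 right; left | left]; f_equal; lia.
Qed.

(** Signed number of crossings, in direction [d], of the part of the boundary
    carrying the weight [o]. *)
Definition cross (o : pos -> Z) (d : dir) (c : pos) : Z :=
  match cellb c, cellb (step c d) with
  | true, false => o c
  | false, true => - o (step c d)
  | _, _ => 0
  end.

Lemma step_comm c d e : step (step c d) e = step (step c e) d.
Proof. destruct d, e; pos_solve. Qed.

(** The two ways to the diagonal neighbour count the same crossings. The steps of the walk supplied
    by [check_corner] identify the weights on both ways. *)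
Lemma cross_curl o c :
  (forall q, ringb q = true -> o (next q) = o q) ->
  cross o DE c + cross o DN (step c DE) = cross o DN c + cross o DE (step c DN).
Proof.
  intros Ho; assert (H := check_at c); unfold check in H.
  apply andb_true_iff in H; destruct H as [H _]; apply andb_true_iff in H; destruct H as [_ H].
  assert (E11 : view_at c 1 1 = cellb (step (step c DE) DN)).
  { unfold view_at; f_equal; pos_solve. }
  assert (Hd : forall q, match ringv (view_at q) && eqd (outv (view_at q)) DE with
    | true => o (step q DE) = o q | false => True end /\
    match ringv (view_at q) && eqd (outv (view_at q)) DN with
    | true => o (step q DN) = o q | false => True end /\
    match ringv (view_at q) && eqd (outv (view_at q)) DS with
    | true => o (step q DS) = o q | false => True end /\
    match ringv (view_at q) && eqd (outv (view_at q)) DW with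
    | true => o (step q DW) = o q | false => True end).
  { intros q; fold (ringb q) (out_dir q); specialize (Ho q); unfold next in Ho.
    destruct (ringb q); [| repeat split; auto].
    repeat split; unfold eqd;
      match goal with |- context [dir_eq_dec ?a ?b] => destruct (dir_eq_dec a b) as [e |] end;
      simpl; auto; rewrite <- e; auto. }
  unfold check_corner in H; cbv zeta in H.
  rewrite view_at_0, E11 in H.
  change (view_at c 1 0) with (cellb (step c DE)) in H.
  change (view_at c 0 1) with (cellb (step c DN)) in H.
  rewrite <- !view_at_step in H.
  unfold cross; rewrite (step_comm c DN DE).
  assert (HA := Hd c); assert (HB := Hd (step c DE)); assert (HC := Hd (step c DN)).
  assert (HD := Hd (step (step c DE) DN)).
  destruct HA as (_ & HA & _), HB as (_ & _ & _ & HB), HC as (HC & _), HD as (_ & _ & HD & _).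
  change (step (step c DE) DW) with (step (step c DE) (opp DE)) in HB.
  change (step (step (step c DE) DN) DS) with (step (step (step c DE) DN) (opp DN)) in HD.
  rewrite step_opp in HB, HD.
  rewrite (step_comm c DN DE) in HC.
  destruct (cellb c), (cellb (step c DE)), (cellb (step c DN)),
    (cellb (step (step c DE) DN)); try lia;
    try (apply andb_true_iff in H; destruct H as [Ha Hb]);
    try rewrite Ha in *; try rewrite Hb in *; try rewrite H in *; cbn [andb] in *; lia.
Qed.

(** * The winding number as a potential *)

Section Potential.

Context (o : pos -> Z) (Ho : forall q, ringb q = true -> o (next q) = o q) (N : Z)
  (HN : forall c, cellb c = true -> - N < fst c < N /\ - N < snd c < N).

Fixpoint row_cross (n : nat) (c : pos) : Z :=
  match n with
  | O => 0
  | S n' => cross o DE c + row_cross n' (step c DE)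
  end.

(** The winding number of the weighted boundary around [c], read off on the
    ray from [c] to the east. *)
Definition pot (c : pos) : Z := row_cross (Z.to_nat (N - fst c)) c.

Lemma cross_same d c : cellb c = cellb (step c d) -> cross o d c = 0.
Proof. unfold cross; intros <-; destruct (cellb c); reflexivity. Qed.

Lemma cell_far c :
  fst c <= - N \/ N <= fst c \/ snd c <= - N \/ N <= snd c -> cellb c = false.
Proof.
  intros H; destruct (cellb c) eqn:E; [apply HN in E; lia | reflexivity].
Qed.

Lemma pot_east c : pot c = cross o DE c + pot (step c DE).
Proof.
  unfold pot; change (fst (step c DE)) with (fst c + 1).
  destruct (Z_lt_le_dec (fst c) N).
  - replace (Z.to_nat (N - fst c)) with (S (Z.to_nat (N - (fst c + 1)))) by lia.
    reflexivity.
  - replace (Z.to_nat (N - fst c)) with 0%nat by lia.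
    replace (Z.to_nat (N - (fst c + 1))) with 0%nat by lia.
    rewrite cross_same; [reflexivity |].
    rewrite !cell_far; [reflexivity | change (fst (step c DE)) with (fst c + 1); lia | lia].
Qed.

(** The potential is defined along eastward rays only; moving the ray up one row, square by square
    with [cross_curl], shows that vertical steps are governed by crossings as well. *)
Lemma pot_north c : pot c = cross o DN c + pot (step c DN).
Proof.
  remember (Z.to_nat (N - fst c)) as k eqn:Hk; revert c Hk.
  induction k as [| k IH]; intros c Hk.
  - unfold pot; replace (fst (step c DN)) with (fst c) by pos_solve.
    rewrite <- Hk; rewrite cross_same; [reflexivity |].
    rewrite !cell_far; [reflexivity | | lia].
    replace (fst (step c DN)) with (fst c) by pos_solve; lia.
  - rewrite pot_east, (pot_east (step c DN)), (IH (step c DE)).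
    + rewrite (step_comm c DN DE).
      assert (Hc := cross_curl o c Ho); lia.
    + replace (fst (step c DE)) with (fst c + 1) by pos_solve; lia.
Qed.

Lemma pot_same c d : cellb c = cellb (step c d) -> pot c = pot (step c d).
Proof.
  intros E; destruct d.
  - rewrite pot_north, cross_same by exact E; reflexivity.
  - rewrite pot_east, cross_same by exact E; reflexivity.
  - rewrite (pot_north (step c DS)), cross_same;
      change DN with (opp DS); rewrite step_opp; auto.
  - rewrite (pot_east (step c DW)), cross_same;
      change DE with (opp DW); rewrite step_opp; auto.
Qed.

Lemma pot_side c d :
  cellb c = true -> cellb (step c d) = false -> pot c = o c + pot (step c d).
Proof.
  intros Hc Hd; destruct d.
  - rewrite pot_north; unfold cross; rewrite Hc, Hd; reflexivity.
  - rewrite pot_east; unfold cross; rewrite Hc, Hd; reflexivity.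
  - rewrite (pot_north (step c DS)); unfold cross; rewrite Hd.
    change DN with (opp DS); rewrite step_opp, Hc; lia.
  - rewrite (pot_east (step c DW)); unfold cross; rewrite Hd.
    change DE with (opp DW); rewrite step_opp, Hc; lia.
Qed.

Lemma pot_empty_row c : (forall x, cellb (x, snd c) = false) -> pot c = 0.
Proof.
  unfold pot; generalize (Z.to_nat (N - fst c)) as n.
  intros n; revert c; induction n as [| n IH]; intros c Hc; [reflexivity |].
  assert (Es : snd (step c DE) = snd c) by pos_solve.
  simpl; rewrite IH by (rewrite Es; exact Hc).
  rewrite cross_same; [reflexivity |].
  replace (step c DE) with (fst c + 1, snd c) by pos_solve.
  replace (cellb c) with (cellb (fst c, snd c)) by (destruct c; reflexivity).
  rewrite !Hc; reflexivity.
Qed.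

Lemma pot_far c :
  fst c <= - N \/ N <= fst c \/ snd c <= - N \/ N <= snd c -> pot c = 0.
Proof.
  assert (Hrow : forall c, snd c <= - N \/ N <= snd c -> pot c = 0).
  { intros c' Hc'; apply pot_empty_row; intros x; apply cell_far; simpl; lia. }
  intros [H | [H | H]]; [| | apply Hrow, H].
  (* From the far west the ray may pass through all of [P]. Moving north over empty cells does not
     change the potential, and it ends in an empty row. *)
  - remember (Z.to_nat (N - snd c)) as k eqn:Hk; revert c H Hk.
    induction k as [| k IH]; intros c H Hk; [apply Hrow; lia |].
    assert (E1 : fst (step c DN) = fst c) by pos_solve.
    assert (E2 : snd (step c DN) = snd c + 1) by pos_solve.
    rewrite (pot_same c DN) by (rewrite !cell_far; [reflexivity | lia | lia]).
    apply IH; lia.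
  - unfold pot; replace (Z.to_nat (N - fst c)) with 0%nat by lia; reflexivity.
Qed.

Definition block_corner (p : pos) : pos := (4 * fst p, 4 * snd p).

Lemma pixel_corner p x y : 0 <= x <= 3 -> 0 <= y <= 3 ->
  pixel (4 * fst p + x, 4 * snd p + y) = p.
Proof.
  intros Hx Hy; unfold pixel; destruct p as [a b]; cbn [fst snd].
  f_equal; Z.to_euclidean_division_equations; lia.
Qed.

Lemma pot_in_block p x y : 0 <= x <= 3 -> 0 <= y <= 3 ->
  pot (4 * fst p + x, 4 * snd p + y) = pot (block_corner p).
Proof.
  intros Hx Hy; remember (Z.to_nat (x + y)) as k eqn:Hk; revert x y Hx Hy Hk.
  induction k as [| k IH]; intros x y Hx Hy Hk.
  - unfold block_corner; f_equal; f_equal; lia.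
  - assert (Hxy : 0 < x \/ 0 < y) by lia; destruct Hxy as [H | H].
    + assert (E : step (4 * fst p + x, 4 * snd p + y) DW =
                  (4 * fst p + (x - 1), 4 * snd p + y)).
      { unfold step, padd; cbn [vec fst snd]; f_equal; lia. }
      rewrite (pot_same _ DW); rewrite E; [apply IH; lia |].
      unfold cellb; rewrite !pixel_corner by lia; reflexivity.
    + assert (E : step (4 * fst p + x, 4 * snd p + y) DS =
                  (4 * fst p + x, 4 * snd p + (y - 1))).
      { unfold step, padd; cbn [vec fst snd]; f_equal; lia. }
      rewrite (pot_same _ DS); rewrite E; [apply IH; lia |].
      unfold cellb; rewrite !pixel_corner by lia; reflexivity.
Qed.

Lemma pot_pixel c : pot c = pot (block_corner (pixel c)).
Proof.
  rewrite <- (pot_in_block (pixel c) (fst c mod 4) (snd c mod 4)).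
  - f_equal; destruct c as [x y]; unfold pixel; cbn [fst snd].
    f_equal; apply Z.div_mod; lia.
  - assert (H := Z.mod_pos_bound (fst c) 4); lia.
  - assert (H := Z.mod_pos_bound (snd c) 4); lia.
Qed.

Lemma pot_pixel_step p d :
  memb p P = memb (step p d) P -> pot (block_corner p) = pot (block_corner (step p d)).
Proof.
  assert (main : forall p d, d = DE \/ d = DN -> memb p P = memb (step p d) P ->
    pot (block_corner p) = pot (block_corner (step p d))).
  { intros q f Hf E.
    (* The cell of the block from which a step in direction [f] lands on the corner cell of the next
       block. *)
    set (x := if eqd f DE then 3 else 0); set (y := if eqd f DE then 0 else 3).
    assert (Hxy : 0 <= x <= 3 /\ 0 <= y <= 3)
      by (unfold x, y; destruct (eqd f DE); lia).
    rewrite <- (pot_in_block q x y) by lia.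
    assert (Es : step (4 * fst q + x, 4 * snd q + y) f = block_corner (step q f)).
    { unfold block_corner, x, y, eqd; destruct Hf as [-> | ->];
        unfold step, padd; cbn [vec fst snd];
        match goal with |- context [dir_eq_dec ?a ?b] => destruct (dir_eq_dec a b) end;
        try congruence; f_equal; lia. }
    rewrite (pot_same _ f), Es; [reflexivity |].
    rewrite Es; unfold cellb; rewrite pixel_corner by lia.
    replace (block_corner (step q f)) with
      (4 * fst (step q f) + 0, 4 * snd (step q f) + 0)
      by (unfold block_corner; f_equal; lia).
    rewrite pixel_corner by lia; exact E. }
  intros E; destruct d; auto.
  - assert (H := main (step p DS) DN (or_intror eq_refl)).
    change DN with (opp DS) in H; rewrite step_opp in H; symmetry; auto.
  - assert (H := main (step p DW) DE (or_introl eq_refl)).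
    change DE with (opp DW) in H; rewrite step_opp in H; symmetry; auto.
Qed.

Lemma adj_step p q : adj p q -> exists d, q = step p d.
Proof.
  unfold adj; destruct p as [a b], q as [x y]; cbn [fst snd]; intros H.
  assert (Hc : (x = a /\ y = b + 1) \/ (x = a + 1 /\ y = b) \/
               (x = a /\ y = b - 1) \/ (x = a - 1 /\ y = b)) by lia.
  destruct Hc as [[-> ->] | [[-> ->] | [[-> ->] | [-> ->]]]];
    [exists DN | exists DE | exists DS | exists DW];
    unfold step, padd; cbn [vec fst snd]; f_equal; lia.
Qed.

Lemma pot_connected (Q : pos -> Prop) p q :
  (forall a b, Q a -> Q b -> memb a P = memb b P) ->
  connected_in Q p q -> pot (block_corner p) = pot (block_corner q).
Proof.
  intros HQ H; induction H as [a b (Ha & Hb & Hab) | | a b c _ IH1 _ IH2].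
  - destruct (adj_step a b Hab) as [d ->]; apply pot_pixel_step; auto.
  - reflexivity.
  - congruence.
Qed.

Lemma memb_false p : memb p P = false <-> ~ In p P.
Proof. rewrite <- memb_In; destruct (memb p P); intuition congruence. Qed.

(** Without holes a free pixel is joined through free pixels to one beyond distance [N]. The
    potential is constant along the way and vanishes at its end. *)
Lemma pot_outside c : hole_free P -> 0 <= N -> cellb c = false -> pot c = 0.
Proof.
  intros Hh HN0 Hc; rewrite pot_pixel; apply memb_false in Hc.
  destruct (Hh _ Hc N) as (q & Hq & Hcon).
  rewrite (pot_connected _ _ _ (fun a b Ha Hb =>
    eq_trans (proj2 (memb_false a) Ha) (eq_sym (proj2 (memb_false b) Hb))) Hcon).
  apply pot_far; unfold block_corner; cbn [fst snd]; lia.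
Qed.

Lemma pot_inside c c' :
  polyomino P -> cellb c = true -> cellb c' = true -> pot c = pot c'.
Proof.
  intros [_ Hp] Hc Hc'; rewrite pot_pixel, (pot_pixel c').
  apply memb_In in Hc, Hc'.
  apply (pot_connected (fun a => In a P)); [| apply Hp; auto].
  intros a b Ha Hb; apply memb_In in Ha, Hb; congruence.
Qed.

(** A weight that is constant along the ring is the height of the potential
    over the outside wherever the ring has a side, so it is the same
    everywhere. *)
Lemma ring_weight c0 d0 :
  polyomino P -> hole_free P -> 0 <= N ->
  cellb c0 = true -> cellb (step c0 d0) = false -> o c0 = 1 ->
  forall c, ringb c = true -> o c = 1.
Proof.
  intros HP HH HN0 Hc0 Hd0 H1.
  assert (main : forall c d, cellb c = true -> cellb (step c d) = false -> o c = 1).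
  { intros c d Hc Hd.
    assert (E1 := pot_side c d Hc Hd); assert (E2 := pot_side c0 d0 Hc0 Hd0).
    rewrite (pot_outside _ HH HN0 Hd) in E1; rewrite (pot_outside _ HH HN0 Hd0) in E2.
    rewrite (pot_inside c c0 HP Hc Hc0) in E1; lia. }
  intros c Hc; assert (Hf := ring_local c Hc).
  destruct (rf_side _ Hf) as [[d Hd] | [d Hd]].
  - apply (main c d); [apply ring_cell, Hc | exact Hd].
  - rewrite <- (Ho c Hc); apply (main (next c) d); [apply ring_cell, (rf_next _ Hf) | exact Hd].
Qed.

End Potential.

End Ring.

(** * The boundary walk *)

Section Walk.

Context (P : poly).

Notation nx := (next P).
Notation go n c := (Nat.iter n nx c).

Fixpoint orbit (n : nat) (c : pos) : list pos :=
  match n with O => [] | S n' => c :: orbit n' (nx c) end.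

Fixpoint walk (n : nat) (c : pos) : list letter :=
  match n with O => [] | S n' => (in_dir P c, out_dir P c) :: walk n' (nx c) end.

Lemma cells_walk n c : cells c (walk n c) = orbit n c.
Proof.
  revert c; induction n as [| n IH]; intros c; simpl; [reflexivity |].
  f_equal; apply IH.
Qed.

Lemma go_S n c : go (S n) c = go n (nx c).
Proof. apply Nat.iter_succ_r. Qed.

Lemma endp_walk n c : endp c (walk n c) = go n c.
Proof.
  revert c; induction n as [| n IH]; intros c; [reflexivity |].
  rewrite go_S; apply IH.
Qed.

Lemma length_walk n c : length (walk n c) = n.
Proof. revert c; induction n; intros c; simpl; auto. Qed.

Lemma length_orbit n c : length (orbit n c) = n.
Proof. revert c; induction n; intros c; simpl; auto. Qed.

Lemma In_orbit n c q : In q (orbit n c) <-> exists i, (i < n)%nat /\ q = go i c.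
Proof.
  revert c; induction n as [| n IH]; intros c; simpl orbit.
  - split; [intros [] | intros (i & Hi & _); lia].
  - simpl In; rewrite IH; split.
    + intros [<- | (i & Hi & ->)]; [exists 0%nat; split; [lia | reflexivity] |].
      exists (S i); split; [lia | symmetry; apply go_S].
    + intros ([| i] & Hi & ->); [auto |].
      right; exists i; split; [lia | apply go_S].
Qed.

Lemma ring_go n c : ringb P c = true -> ringb P (go n c) = true.
Proof.
  intros Hc; induction n as [| n IH]; [exact Hc |].
  exact (rf_next _ _ (ring_local P _ IH)).
Qed.

Lemma linked_walk n c :
  ringb P c = true -> linked (in_dir P c) (walk n c) (in_dir P (go n c)).
Proof.
  revert c; induction n as [| n IH]; intros c Hc; [reflexivity |].
  rewrite go_S; simpl; split; [reflexivity |].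
  rewrite <- (rf_next_in _ _ (ring_local P c Hc)).
  apply IH, (rf_next _ _ (ring_local P c Hc)).
Qed.

Lemma no_uturn_walk n c : ringb P c = true -> no_uturn (walk n c).
Proof.
  revert c; induction n as [| n IH]; intros c Hc l; simpl; [intros [] |].
  intros [<- | Hl].
  - exact (rf_no_uturn _ _ (ring_local P c Hc)).
  - exact (IH _ (rf_next _ _ (ring_local P c Hc)) l Hl).
Qed.

Lemma walk_snoc n c :
  walk (S n) c = walk n c ++ [(in_dir P (go n c), out_dir P (go n c))].
Proof.
  revert c; induction n as [| n IH]; intros c; [reflexivity |].
  rewrite go_S; change (walk (S (S n)) c) with
    ((in_dir P c, out_dir P c) :: walk (S n) (nx c)).
  rewrite IH; reflexivity.
Qed.

Lemma next_inj c c' :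
  ringb P c = true -> ringb P c' = true -> nx c = nx c' -> c = c'.
Proof.
  intros Hc Hc' E; rewrite <- (prev_next P c Hc), E; apply prev_next, Hc'.
Qed.

Lemma go_cancel i j c : ringb P c = true -> go i c = go (i + j) c -> c = go j c.
Proof.
  intros Hc; induction i as [| i IH]; [auto |].
  simpl; intros E; apply IH.
  apply next_inj; [apply ring_go, Hc | apply ring_go, Hc | exact E].
Qed.

(** The walk is injective on ring cells, so a repetition can be shifted back to the start; if [c]
    does not recur, nothing does. *)
Lemma NoDup_orbit n c :
  ringb P c = true -> (forall j, (1 <= j < n)%nat -> go j c <> c) -> NoDup (orbit n c).
Proof.
  intros Hc H.
  assert (H' : forall i j, (i < j < n)%nat -> go i c <> go j c).
  { intros i j Hij E; apply (H (j - i)%nat); [lia |].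
    symmetry; apply (go_cancel i); [exact Hc |].
    replace (i + (j - i))%nat with j by lia; exact E. }
  clear H Hc; revert c H'; induction n as [| n IH]; intros c H; simpl; constructor.
  - rewrite In_orbit; intros (i & Hi & E); rewrite <- go_S in E.
    apply (H 0%nat (S i)); [lia | exact E].
  - apply IH; intros i j Hij E; rewrite <- !go_S in E; apply (H (S i) (S j)); [lia | exact E].
Qed.

(** Finitely many ring cells force a return to [c] by the pigeonhole principle, and the least return
    time gives a cycle without repetitions. *)
Lemma period_exists G c :
  (forall q, ringb P q = true -> In q G) -> ringb P c = true ->
  exists m, (1 <= m)%nat /\ go m c = c /\ NoDup (orbit m c).
Proof.
  intros HG Hc.
  assert (Hex : exists m, (1 <= m)%nat /\ go m c = c).
  { apply NNPP; intros Hn.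
    assert (Hnd : NoDup (orbit (S (length G)) c)).
    { apply NoDup_orbit; [exact Hc |]; intros j Hj E; apply Hn; exists j; split; [lia | exact E]. }
    apply NoDup_incl_length with (l' := G) in Hnd.
    - rewrite length_orbit in Hnd; lia.
    - intros q Hq; apply In_orbit in Hq; destruct Hq as (i & _ & ->).
      apply HG, ring_go, Hc. }
  destruct Hex as [m Hm]; induction m as [m IH] using lt_wf_ind.
  destruct (classic (exists j, (1 <= j < m)%nat /\ go j c = c)) as [(j & Hj & E) | Hn].
  - apply (IH j); [lia | split; [lia | exact E]].
  - exists m; split; [apply Hm |]; split; [apply Hm |].
    apply NoDup_orbit; [exact Hc |]; intros j Hj E; apply Hn; eauto.
Qed.

(** The indicator function of the orbit is a weight constant along the walk, and it is 1 at a cell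
    with an exposed side. By [ring_weight] it is 1 on the whole ring. *)
Lemma orbit_full G m c d N :
  polyomino P -> hole_free P -> 0 <= N ->
  (forall q, cellb P q = true -> - N < fst q < N /\ - N < snd q < N) ->
  (forall q, ringb P q = true -> In q G) ->
  cellb P c = true -> cellb P (step c d) = false ->
  (1 <= m)%nat -> go m c = c ->
  forall q, In q (orbit m c) <-> ringb P q = true.
Proof.
  intros HP HH HN0 HN HG Hc Hd Hm Em q.
  assert (Rc : ringb P c = true) by (eapply ring_of_side; eauto).
  split.
  - intros Hq; apply In_orbit in Hq; destruct Hq as (i & _ & ->); apply ring_go, Rc.
  - set (o := fun p => if in_dec pos_eq_dec p (orbit m c) then 1 else 0).
    assert (Ho : forall p, ringb P p = true -> o (nx p) = o p).
    { intros p Hp; unfold o.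
      assert (E : In (nx p) (orbit m c) <-> In p (orbit m c)).
      { rewrite !In_orbit; split.
        - intros ([| i] & Hi & E).
          + exists (m - 1)%nat; split; [lia |].
            apply next_inj; [exact Hp | apply ring_go, Rc |].
            rewrite E; change (c = go (S (m - 1)) c).
            replace (S (m - 1)) with m by lia; auto.
          + exists i; split; [lia |].
            apply next_inj; [exact Hp | apply ring_go, Rc | exact E].
        - intros (i & Hi & ->); destruct (Nat.eq_dec (S i) m) as [Ei | Ei].
          + exists 0%nat; split; [lia |].
            change (go (S i) c = c); rewrite Ei; exact Em.
          + exists (S i); split; [lia | reflexivity]. }
      destruct (in_dec pos_eq_dec (nx p) (orbit m c)), (in_dec pos_eq_dec p (orbit m c));
        tauto. }
    intros Hq.
    assert (H1 : o q = 1).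
    { apply (ring_weight P o Ho N HN c d HP HH HN0 Hc Hd); [| exact Hq].
      unfold o; destruct (in_dec pos_eq_dec c (orbit m c)) as [| n]; [reflexivity |].
      exfalso; apply n, In_orbit; exists 0%nat; split; [lia | reflexivity]. }
    unfold o in H1; destruct (in_dec pos_eq_dec q (orbit m c)); [assumption | discriminate].
Qed.

(** The turning cells of the orbit are distinct, and each is among the four cells around some
    vertex. *)
Lemma turns_walk n c V :
  ringb P c = true -> NoDup (orbit n c) -> (forall v, is_vertex P v -> In v V) ->
  (turns (walk n c) <= 4 * length V)%nat.
Proof.
  intros Hc Hnd HV.
  set (f := fun q => negb (straight (in_dir P q, out_dir P q))).
  assert (E : turns (walk n c) = length (filter f (orbit n c))).
  { unfold turns; clear; revert c; induction n as [| n IH]; intros c; [reflexivity |].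
    simpl; unfold f at 1; destruct (straight (in_dir P c, out_dir P c)); simpl; auto. }
  rewrite E.
  assert (Hl : length (flat_map corner_cells V) = (4 * length V)%nat).
  { clear; induction V as [| v V IH]; [reflexivity |].
    simpl flat_map; simpl length; simpl in IH; rewrite IH; lia. }
  rewrite <- Hl; apply NoDup_incl_length; [apply NoDup_filter, Hnd |].
  intros q Hq; apply filter_In in Hq; destruct Hq as [Hq Ht].
  apply In_orbit in Hq; destruct Hq as (i & _ & Eq).
  assert (Rq : ringb P q = true) by (rewrite Eq; apply ring_go, Hc).
  destruct (turn_at_vertex P q Rq) as (v & Hv & Hin).
  - unfold f, straight in Ht; simpl in Ht.
    destruct (dir_eq_dec (in_dir P q) (out_dir P q)); [discriminate | congruence].
  - apply in_flat_map; exists v; auto.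
Qed.

End Walk.

(** Without turns every letter gains one unit of height. A nonempty closed walk therefore turns
    somewhere, and this is how [1 <= k] is obtained. *)
Lemma straight_height d w e p :
  linked d w e -> turns w = 0%nat -> height d (endp p w) = height d p + Z.of_nat (length w).
Proof.
  revert d p; induction w as [| [x y] w IH]; intros d p; [simpl; lia |].
  unfold turns; simpl; intros [-> Hl].
  destruct (straight (d, y)) eqn:E; simpl; [| discriminate]; intros Ht.
  assert (y = d).
  { unfold straight in E; simpl in E; destruct (dir_eq_dec d y); congruence. }
  subst y; rewrite (IH d) by assumption; rewrite height_step; lia.
Qed.

Lemma trace_letter P n c tw q x :
  map ct_letter tw = walk P n c -> In (q, x) (trace c tw) ->
  ct_letter x = (in_dir P q, out_dir P q).
Proof.
  revert c tw; induction n as [| n IH]; intros c [| y tw]; simpl; try discriminate; [tauto |].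
  intros [= E1 E2 E3] [[= <- <-] | H].
  - unfold ct_letter; congruence.
  - apply (IH (next P c) tw E3); rewrite E2 in H; exact H.
Qed.

(** * The filled ring *)

Section RingAssembly.

Context (P : poly) (m : nat) (c : pos) (d : dir) (tw : list ctile) (G : list pos)
  (HG : forall q, cellb P q = true -> In q G)
  (Rc : ringb P c = true)
  (Hfull : forall q, In q (orbit P m c) <-> ringb P q = true)
  (Hnd : NoDup (orbit P m c)) (Hperiod : Nat.iter m (next P) c = c)
  (Htw : map ct_letter tw = walk P m c) (Hchain : chain C0 d tw C0 d).

Lemma occupied_ring q : occupied (lay c tw) q <-> ringb P q = true.
Proof. rewrite occupied_lay, Htw, cells_walk; apply Hfull. Qed.

Lemma ring_tile q t :
  lay c tw q = Some t ->
  exists x, In (q, x) (trace c tw) /\ t = ct_tile x /\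
    ct_in x = in_dir P q /\ ct_out x = out_dir P q /\ ringb P q = true.
Proof.
  intros H; assert (Hq := occupied_some _ _ _ H); apply occupied_ring in Hq.
  apply lay_trace in H; destruct H as (x & Hx & ->); exists x.
  assert (E := trace_letter P m c tw q x Htw Hx); unfold ct_letter in E.
  injection E as E1 E2; auto.
Qed.

(** The path has no open end left: the exit of its last cell leads to its first cell, with matching
    colour [C0] and direction [d]. *)
Lemma ring_successor q x :
  In (q, x) (trace c tw) ->
  exists y, In (step q (ct_out x), y) (trace c tw) /\
    ct_in y = ct_out x /\ ct_ci y = ct_co x.
Proof.
  intros Hx; destruct (chain_next _ _ _ _ _ _ _ _ Hchain Hx) as [H | (E1 & E2 & E3)];
    [exact H |].
  rewrite Htw, endp_walk, Hperiod in E1.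
  destruct tw as [| y tw']; [contradiction |]; destruct Hchain as (F1 & F2 & _).
  exists y; rewrite E1, E2, E3; simpl; auto.
Qed.

Lemma ring_bond q t t' :
  lay c tw q = Some t -> lay c tw (next P q) = Some t' ->
  (0 < str (side t (out_dir P q)) (side t' (opp (out_dir P q))))%nat.
Proof.
  intros H H'; destruct (ring_tile q t H) as (x & Hx & -> & Ei & Eo & Rq).
  destruct (ring_successor q x Hx) as (y & Hy & F1 & F2).
  rewrite Eo in Hy; fold (next P q) in Hy.
  assert (Ht' : t' = ct_tile y).
  { assert (E : lay c tw (next P q) = Some (ct_tile y)).
    { apply trace_lay; [| exact Hy]; rewrite Htw, cells_walk; exact Hnd. }
    congruence. }
  assert (Ey := trace_letter P m c tw _ y Htw Hy); unfold ct_letter in Ey.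
  injection Ey as Ey1 Ey2.
  assert (Hu := rf_no_uturn _ _ (ring_local P _ (rf_next _ _ (ring_local P q Rq)))).
  rewrite <- Ey1, <- Ey2 in Hu.
  rewrite Ht', !side_ct_tile; unfold ct_side; rewrite <- Eo.
  destruct (dir_eq_dec (ct_out x) (ct_out x)); [| congruence].
  destruct (dir_eq_dec (opp (ct_out x)) (ct_out y)); [congruence |].
  destruct (dir_eq_dec (opp (ct_out x)) (opp (ct_in y))); [| congruence].
  rewrite F2; destruct (ct_co x); simpl; lia.
Qed.

Lemma ring_free_side q t f :
  lay c tw q = Some t -> ringb P (step q f) = false ->
  side t f = if cellb P (step q f) then inner_glue else 0%nat.
Proof.
  intros H Hf; destruct (ring_tile q t H) as (x & _ & -> & Ei & Eo & Rq).
  assert (HF := ring_local P q Rq).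
  assert (N1 : f <> out_dir P q).
  { intros ->; assert (E := rf_next _ _ HF); unfold next in E; congruence. }
  assert (N2 : f <> opp (in_dir P q)).
  { intros ->; assert (E := rf_prev _ _ HF); unfold prev in E; congruence. }
  rewrite side_ct_tile; unfold ct_side; rewrite Ei, Eo.
  destruct (dir_eq_dec f (out_dir P q)); [congruence |].
  destruct (dir_eq_dec f (opp (in_dir P q))); [congruence |].
  apply (rf_free _ _ HF f N1 N2).
Qed.

Lemma inside_spec q : insideb P q = true <-> cellb P q = true /\ ringb P q = false.
Proof. unfold insideb; rewrite andb_true_iff, negb_true_iff; tauto. Qed.

Lemma ring_encloses : encloses (lay c tw) (insideb P).
Proof.
  split.
  - apply finite_lay.
  - exists c; apply occupied_ring, Rc.
  - intros S HS q q' Hq Hq' Sq.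
    assert (Hgo : forall i, S (Nat.iter i (next P) q) /\ ringb P (Nat.iter i (next P) q) = true).
    { apply occupied_ring in Hq.
      induction i as [| i [IH1 IH2]]; [split; [exact Sq | exact Hq] |].
      assert (R' := rf_next _ _ (ring_local P _ IH2)).
      split; [| exact R']; apply HS; [apply occupied_ring, IH2 | apply occupied_ring, R' | exact IH1]. }
    apply occupied_ring, Hfull, In_orbit in Hq, Hq'.
    destruct Hq as (i & Hi & ->), Hq' as (j & Hj & ->).
    (* Only forward steps are available, so the cell with index [j] is reached from that with index
       [i] by going round past the start. *)
    replace (Nat.iter j (next P) c) with
      (Nat.iter (m - i + j) (next P) (Nat.iter i (next P) c)); [apply Hgo |].
    rewrite <- Nat.iter_add; replace (m - i + j + i)%nat with (j + m)%nat by lia.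
    rewrite Nat.iter_add, Hperiod; reflexivity.
  - exists G; intros q Hq; apply HG, inside_spec, Hq.
  - intros q Hq; destruct (lay c tw q) eqn:E; [| reflexivity].
    apply occupied_some, occupied_ring in E; apply inside_spec in Hq; destruct Hq; congruence.
  - intros q f Hq; destruct (inside_step P q f Hq); [auto | right; apply occupied_ring; auto].
  - intros q t f Ht Hi; apply inside_spec in Hi; destruct Hi as [Hi1 Hi2].
    rewrite (ring_free_side q t f Ht Hi2), Hi1; reflexivity.
  - intros q t f Ht Hi Ho.
    assert (Hr : ringb P (step q f) = false).
    { destruct (ringb P (step q f)) eqn:E; [exfalso; apply Ho, occupied_ring, E | reflexivity]. }
    rewrite (ring_free_side q t f Ht Hr).
    unfold insideb in Hi; rewrite Hr, andb_true_r in Hi; rewrite Hi; reflexivity.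
Qed.

Notation whole := (fill (lay c tw) (insideb P)).

(** Adjacent ring cells are consecutive on the walk and share a joint. Every other contact involves
    a filler, which bonds to fillers and to the inner sides of the ring. *)
Lemma whole_bonds q f t t' :
  whole q = Some t -> whole (step q f) = Some t' ->
  (0 < str (side t f) (side t' (opp f)))%nat.
Proof.
  assert (HE := ring_encloses).
  unfold fill; destruct (lay c tw q) as [u |] eqn:Eq;
    destruct (lay c tw (step q f)) as [u' |] eqn:Eq'.
  - intros [= <-] [= <-].
    destruct (dir_eq_dec f (out_dir P q)) as [-> | N1]; [apply ring_bond; auto |].
    destruct (ring_tile q u Eq) as (_ & _ & _ & _ & _ & Rq).
    destruct (dir_eq_dec f (opp (in_dir P q))) as [-> | N2].
    + fold (prev P q) in Eq'.
      assert (E : out_dir P (prev P q) = in_dir P q) by apply (rf_prev_out _ _ (ring_local P q Rq)).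
      rewrite str_sym, <- E, opp_opp; apply ring_bond; [exact Eq' |].
      rewrite next_prev by exact Rq; exact Eq.
    + destruct (rf_free _ _ (ring_local P q Rq) f N1 N2) as [Hn _].
      apply occupied_some, occupied_ring in Eq'; congruence.
  - destruct (insideb P (step q f)) eqn:Ei; [| discriminate]; intros [= <-] [= <-].
    rewrite side_filler, (enc_inner _ _ HE q u f Eq Ei); simpl; lia.
  - destruct (insideb P q) eqn:Ei; [| discriminate]; intros [= <-] [= <-].
    rewrite side_filler, (enc_inner _ _ HE (step q f) u' (opp f) Eq');
      [simpl; lia | rewrite step_opp; exact Ei].
  - destruct (insideb P q); [| discriminate].
    destruct (insideb P (step q f)); [| discriminate]; intros [= <-] [= <-].
    rewrite !side_filler; simpl; lia.
Qed.

Lemma whole_connected : fully_connected str whole.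
Proof.
  intros p t t'; rewrite <- step_east, <- step_north.
  split; intros H H'; [apply (whole_bonds p DE) | apply (whole_bonds p DN)]; auto.
Qed.

Lemma cellb_scaled q : cellb P q = true <-> scaled 4 P q.
Proof.
  unfold cellb, scaled; rewrite memb_In; split.
  - intros H; exists (pixel q); split; [exact H |]; unfold pixel; cbn [fst snd].
    Z.to_euclidean_division_equations; lia.
  - intros (p & Hp & Hx & Hy); replace (pixel q) with p; [exact Hp |].
    destruct p as [x y]; unfold pixel; cbn [fst snd] in *.
    f_equal; Z.to_euclidean_division_equations; lia.
Qed.

Lemma whole_shape : has_shape whole (scaled 4 P).
Proof.
  exists (0, 0); intros q; rewrite psub_0.
  rewrite <- cellb_scaled, occupied_fill, occupied_ring, inside_spec.
  destruct (ringb P q) eqn:E; [| intuition congruence].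
  apply ring_cell in E; tauto.
Qed.

End RingAssembly.

(** * Size bounds and the final system *)

Definition grid (a b : Z) (s : nat) : list pos :=
  list_prod (map (fun i => 4 * a + Z.of_nat i) (seq 0 (4 * s)))
            (map (fun i => 4 * b + Z.of_nat i) (seq 0 (4 * s))).

Lemma grid_length a b s : length (grid a b s) = (16 * (s * s))%nat.
Proof.
  etransitivity; [apply length_prod |]; rewrite !length_map, length_seq; lia.
Qed.

Lemma cell_in_square P a b s q :
  in_square P a b s -> cellb P q = true ->
  4 * a <= fst q < 4 * a + 4 * Z.of_nat s /\ 4 * b <= snd q < 4 * b + 4 * Z.of_nat s.
Proof.
  intros H Hq; unfold cellb in Hq; apply memb_In in Hq; apply H in Hq.
  unfold pixel in Hq; cbn [fst snd] in Hq.
  Z.to_euclidean_division_equations; lia.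
Qed.

Lemma cell_in_grid P a b s q :
  in_square P a b s -> cellb P q = true -> In q (grid a b s).
Proof.
  intros H Hq; assert (B := cell_in_square P a b s q H Hq).
  destruct q as [x y]; cbn [fst snd] in B; apply in_prod; apply in_map_iff.
  - exists (Z.to_nat (x - 4 * a)); rewrite in_seq; lia.
  - exists (Z.to_nat (y - 4 * b)); rewrite in_seq; lia.
Qed.

Lemma east_side_exists P N q :
  (forall c, cellb P c = true -> fst c < N) -> cellb P q = true ->
  exists c, cellb P c = true /\ cellb P (step c DE) = false.
Proof.
  intros HN; remember (Z.to_nat (N - fst q)) as k eqn:Hk; revert q Hk.
  induction k as [| k IH]; intros q Hk Hq; assert (H := HN q Hq); [lia |].
  destruct (cellb P (step q DE)) eqn:E; [| eauto].
  apply (IH (step q DE)); [| exact E].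
  change (fst (step q DE)) with (fst q + 1); lia.
Qed.

Theorem theorem3 :
  exists C1 C2 C3 : nat,
  forall (P : poly) (k n : nat),
    polyomino P -> hole_free P -> vertex_count P k -> min_square_side P n ->
    exists S : system,
      valid_system 1 S /\
      (sys_stages S <= C1 * (Nat.log2 n + 1) ^ 2)%nat /\
      glue_complexity_le S 18 /\
      tile_complexity_le S C2 /\
      (sys_bins S <= C3 * k)%nat /\
      constructs_fc 1 S (scaled 4 P).
Proof.
  (* There are [L + 3 = 4 * Nat.log2 n + 16] stages, at most 16 times [(Nat.log2 n + 1) ^ 2]. The
     bins number 9 per slot with 2 slots per run, and there are at most [8 * k + 1 <= 9 * k] runs,
     so 162 times [k] suffice. *)
  exists 16%nat, 145%nat, 162%nat.
  intros P k n HP HH (V & _ & HV & HVk) ((a & b & Hsq) & _).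
  set (N := 4 * Z.abs a + 4 * Z.abs b + 4 * Z.of_nat n + 1).
  assert (HN : forall q, cellb P q = true -> - N < fst q < N /\ - N < snd q < N).
  { intros q Hq; assert (B := cell_in_square P a b n q Hsq Hq); lia. }
  assert (HG := cell_in_grid P a b n); set (G := grid a b n) in *.
  assert (HGr : forall q, ringb P q = true -> In q G)
    by (intros q Hq; apply HG; [exact Hsq | apply ring_cell, Hq]).
  assert (Hc0 : exists c, cellb P c = true /\ cellb P (step c DE) = false).
  { destruct HP as [Hne _]; destruct P as [| p P']; [congruence |].
    apply (east_side_exists _ N (4 * fst p + 0, 4 * snd p + 0)).
    - intros q Hq; apply HN in Hq; lia.
    - unfold cellb; rewrite pixel_corner by lia; apply memb_In; left; reflexivity. }
  destruct Hc0 as (c & Hc & Hce).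
  assert (Rc : ringb P c = true) by (eapply ring_of_side; eauto).
  destruct (period_exists P G c HGr Rc) as (m & Hm & Hper & Hnd).
  assert (Hfull := orbit_full P G m c DE N HP HH ltac:(lia) HN HGr Hc Hce Hm Hper).
  (* Two cells at least are needed, for a nonempty path has to remain once the closing cell is taken
     away. *)
  assert (Hm2 : exists m', m = S (S m')).
  { destruct m as [| [| m']]; [lia | | eauto]; exfalso.
    exact (step_neq _ _ Hper). }
  destruct Hm2 as [m' Em].
  assert (Hmlen : (m <= 16 * (n * n))%nat).
  { rewrite <- (grid_length a b n), <- (length_orbit P m c).
    apply NoDup_incl_length; [exact Hnd |]; intros q Hq; apply HGr, Hfull, Hq. }
  assert (Hlink := linked_walk P m c Rc); rewrite Hper in Hlink.
  assert (Hturn : (turns (walk P m c) <= 4 * k)%nat).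
  { rewrite <- HVk; apply turns_walk; [exact Rc | exact Hnd | intros v; apply HV]. }
  assert (Hk : (1 <= k)%nat).
  { destruct (Nat.eq_dec (turns (walk P m c)) 0) as [E | E]; [| lia]; exfalso.
    assert (Hh := straight_height _ _ _ c Hlink E).
    rewrite endp_walk, Hper, length_walk in Hh; lia. }
  (* The cycle is cut before its last cell. The letter [(zi, zo)] of that cell becomes the closing
     tile, and the rest is the word for the program. *)
  assert (Ew : walk P m c = walk P (S m') c ++
    [(in_dir P (Nat.iter (S m') (next P) c), out_dir P (Nat.iter (S m') (next P) c))])
    by (rewrite Em; apply walk_snoc).
  set (u := walk P (S m') c) in *.
  set (zi := in_dir P (Nat.iter (S m') (next P) c)) in *.
  set (zo := out_dir P (Nat.iter (S m') (next P) c)) in *.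
  assert (Hlu : linked zo u zi).
  { rewrite Ew in Hlink; apply linked_app in Hlink.
    destruct Hlink as (e & H1 & H2); simpl in H2; destruct H2 as [<- E].
    rewrite E; exact H1. }
  destruct (linked_runs _ _ _ Hlu) as (runs & Hruns & Hrl & Hrt).
  assert (Hul : length u = S m') by apply length_walk.
  (* Chosen as [2 * (Nat.log2 n + 1) + 4], so that [2 ^ K] exceeds the [16 * n * n] cells of the
     scaled square. It then exceeds the length of the ring, hence every run count and the number of
     runs. *)
  set (K := (2 * Nat.log2 n + 6)%nat).
  assert (HK : (16 * (n * n) < 2 ^ K)%nat).
  { unfold K; destruct (Nat.eq_dec n 0) as [-> | Hn0].
    - apply Nat.neq_0_lt_0, Nat.pow_nonzero; lia.
    - destruct (Nat.log2_spec n) as [_ H]; [lia |].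
      replace (2 * Nat.log2 n + 6)%nat with (S (Nat.log2 n) + S (Nat.log2 n) + 4)%nat by lia.
      rewrite !(Nat.pow_add_r 2); change (2 ^ 4)%nat with 16%nat; nia. }
  assert (Hcount : forall l e, In (l, e) runs -> (e < 2 ^ K)%nat).
  { intros l e Hle; apply expand_length_count in Hle; rewrite Hruns in Hle; lia. }
  assert (Hlen : (length runs <= 2 ^ K)%nat) by lia.
  assert (Hrne : runs <> []) by (intros ->; rewrite <- Hruns in Hul; discriminate).
  set (B := width runs).
  assert (HB : (0 < B)%nat) by (apply width_pos, Hrne).
  assert (Hword := word_runs runs K Hcount Hlen Hrne); rewrite Hruns in Hword.
  set (L := (2 * K + 1)%nat) in *.
  assert (Hgood : good (u ++ [(zi, zo)])).
  { rewrite <- Ew; split; [| split; [apply no_uturn_walk, Rc | eauto]].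
    intros p; replace p with (padd c (psub p c)) by pos_solve.
    rewrite cells_padd, cells_walk; apply FinFun.Injective_map_NoDup; [| exact Hnd].
    intros q q' E; rewrite <- (psub_padd q (psub p c)), E; apply psub_padd. }
  assert (Hclosed : forall p, endp p (u ++ [(zi, zo)]) = p).
  { rewrite <- Ew; intros p; replace p with (padd c (psub p c)) by pos_solve.
    rewrite endp_padd, endp_walk, Hper; reflexivity. }
  set (base := run_base runs) in *; set (prog := run_prog runs K) in *.
  assert (Hprog : forall s i j, fst (prog s i) = Some j \/ snd (prog s i) = Some j -> (j < B)%nat)
    by apply run_prog_lt.
  assert (Hune : u <> []) by (intros E; rewrite E in Hul; discriminate).
  rewrite <- Hword in Hlu, Hgood, Hclosed, Hune.
  set (tw := ring_tiling base prog L zi zo).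
  assert (Htw : map ct_letter tw = walk P m c)
    by (unfold tw; rewrite map_letter_ring, Hword; symmetry; exact Ew).
  assert (Hchain := chain_ring base prog L zi zo Hune Hlu : chain C0 zo tw C0 zo).
  assert (HGc : forall q, cellb P q = true -> In q G) by auto.
  assert (Henc := ring_encloses P m c tw G HGc Rc Hfull Hper Htw).
  assert (Hout := program_output base prog L B HB Hprog zi zo Hune Hlu Hgood Hclosed _ c Henc).
  exists (program_system base prog L B zi zo); split; [| split; [| split; [| split; [| split]]]].
  - apply program_system_valid; assumption.
  - change ((L + 3 <= 16 * (Nat.log2 n + 1) ^ 2)%nat); unfold L, K; simpl Nat.pow; nia.
  - apply program_system_glues; assumption.
  - apply program_system_tiles; assumption.
  - change ((9 * B <= 162 * k)%nat); unfold B, width.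
    assert (Ht : (turns u <= turns (walk P m c))%nat)
      by (rewrite Ew; unfold turns; rewrite filter_app, length_app; lia).
    lia.
  - exists (fill (lay c tw) (insideb P)); split; [| split; [| split]].
    + apply Hout; exists (0, 0); symmetry; apply translate_0.
    + eapply whole_connected; eassumption.
    + eapply whole_shape; eassumption.
    + intros A HA; apply Hout in HA; destruct HA as [v ->]; exists v; reflexivity.
Qed.
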